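(* Let $k$ be an algebraically closed field of characteristic $0$ and $\alpha\in k$ with $\alpha(1-\alpha^2)\neq 0$. Then the line scheme $\mathcal L(\alpha)\subset\mathbb P^5$ of $A(\alpha)$ is a reduced scheme of degree twenty.
   Context: $A(\alpha)$ is the $k$-algebra on degree-one generators $x_1,\dots,x_4$ with defining relations $x_3x_1+x_1x_3=0$, $x_3x_2-x_2x_3=0$, $2x_2^2+\alpha x_3^2=x_1^2$, $x_4x_1+x_1x_4=0$, $x_2^2-x_4^2=0$, $x_4x_2+x_2x_4=x_3^2$. Its line scheme is realized as follows. Let \[ \mathcal M(\alpha)=\begin{bmatrix} \alpha u_1 & u_4 & u_3 & 0 & \alpha v_1 & v_4 & v_3 & 0\\ 0 & u_1 & 0 & 0 & 0 & v_1 & 0 & 0\\ -u_3 & 0 & u_1 & 0 & -v_3 & 0 & v_1 & 0\\ -u_4 & 0 & 0 & u_1 & -v_4 & 0 & 0 & v_1\\ u_2 & 0 & 0 & 0 & v_2 & 0 & 0 & 0\\ 0 & \alpha u_2-2u_4 & -2u_3 & \alpha u_4 & 0 & \alpha v_2-2v_4 & -2v_3 & \alpha v_4\\ 0 & u_3 & u_2 & 0 & 0 & v_3 & v_2 & 0\\ 0 & -u_4 & 0 & u_2 & 0 & -v_4 & 0 & v_2\\ 0 & 0 & 0 & u_3 & 0 & 0 & 0 & v_3\\ 0 & 0 & u_4 & 0 & 0 & 0 & v_4 & 0 \end{bmatrix}. \] Each of its forty-five $8\times 8$ minors is a polynomial in $N_{ij}=u_iv_j-u_jv_i$, $1\le i<j\le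 4$. Substituting $N_{12}\mapsto M_{34}$, $N_{13}\mapsto -M_{24}$, $N_{14}\mapsto M_{23}$, $N_{23}\mapsto M_{14}$, $N_{24}\mapsto -M_{13}$, $N_{34}\mapsto M_{12}$ yields forty-five quartic forms in the homogeneous coordinates $(M_{12},M_{13},M_{14},M_{23},M_{24},M_{34})$ of $\mathbb P^5$. The line scheme $\mathcal L(\alpha)$ is the closed subscheme of $\mathbb P^5$ defined by these forty-five quartics together with $P=M_{12}M_{34}-M_{13}M_{24}+M_{14}M_{23}$. *)

(* Defs.v *)
From HB Require Import structures.
From mathcomp Require Import all_boot all_order all_algebra.
From mathcomp Require Import mpoly.
Set Implicit Arguments. Unset Strict Implicit. Unset Printing Implicit Defensive.
Import Order.TTheory GRing.Theory.
Local Open Scope ring_scope.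

Section LineScheme.
Variable k : fieldType.

Definition uu (i : nat) : {mpoly k[8]} := 'X_(inord i.-1).
Definition vv (i : nat) : {mpoly k[8]} := 'X_(inord (i + 3)).
Definition Nuv (i j : nat) : {mpoly k[8]} := uu i * vv j - uu j * vv i.

Definition Mrows (a : k) : seq (seq {mpoly k[8]}) :=
  let c := fun x : k => x%:MP_[8] in
  let u := uu in let v := vv in
  [:: [:: c a * u 1; u 4; u 3; 0; c a * v 1; v 4; v 3; 0];
      [:: 0; u 1; 0; 0; 0; v 1; 0; 0];
      [:: - u 3; 0; u 1; 0; - v 3; 0; v 1; 0];
      [:: - u 4; 0; 0; u 1; - v 4; 0; 0; v 1];
      [:: u 2; 0; 0; 0; v 2; 0; 0; 0];
      [:: 0; c a * u 2 - c 2 * u 4; - (c 2 * u 3); c a * u 4;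
          0; c a * v 2 - c 2 * v 4; - (c 2 * v 3); c a * v 4];
      [:: 0; u 3; u 2; 0; 0; v 3; v 2; 0];
      [:: 0; - u 4; 0; u 2; 0; - v 4; 0; v 2];
      [:: 0; 0; 0; u 3; 0; 0; 0; v 3];
      [:: 0; 0; u 4; 0; 0; 0; v 4; 0] ].

Definition Mmat (a : k) : 'M[{mpoly k[8]}]_(10, 8) :=
  \matrix_(i < 10, j < 8) nth 0 (nth [::] (Mrows a) i) j.

Definition minor8 (a : k) (f : 'I_8 -> 'I_10) : {mpoly k[8]} :=
  \det (rowsub f (Mmat a)).
Definition incr_sel (f : 'I_8 -> 'I_10) : Prop :=
  forall i j : 'I_8, (i < j)%N -> (f i < f j)%N.

Definition MM (i : nat) : {mpoly k[6]} := 'X_(inord i).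
Definition M12 := MM 0. Definition M13 := MM 1. Definition M14 := MM 2.
Definition M23 := MM 3. Definition M24 := MM 4. Definition M34 := MM 5.

(* The substitution: a form q(M) corresponds to the polynomial Q(N) with
   q(M) = Q(M34, -M24, M23, M14, -M13, M12); equivalently Q(N) = q(sigma N)
   where M12 := N34, M13 := -N24, M14 := N23, M23 := N14, M24 := -N13, M34 := N12. *)
Definition sigmaN : 6.-tuple {mpoly k[8]} :=
  [tuple Nuv 3 4; - Nuv 2 4; Nuv 2 3; Nuv 1 4; - Nuv 1 3; Nuv 1 2].

Definition Pform : {mpoly k[6]} := M12 * M34 - M13 * M24 + M14 * M23.

(* Generators of the defining ideal of L(alpha): P together with the quartic
   forms obtained from the 8x8 minors by the substitution N_ij |-> M_... *)
Definition line_gens (a : k) (q : {mpoly k[6]}) : Prop :=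
  q = Pform \/
  (q \is 4.-homog /\
   exists f : 'I_8 -> 'I_10, incr_sel f /\ q \mPo sigmaN = minor8 a f).

Definition in_ideal n (G : {mpoly k[n]} -> Prop) (p : {mpoly k[n]}) : Prop :=
  exists s : seq ({mpoly k[n]} * {mpoly k[n]}),
    (forall x, x \in s -> G x.2) /\ p = \sum_(x <- s) x.1 * x.2.

Definition in_saturation n (G : {mpoly k[n]} -> Prop) (p : {mpoly k[n]}) : Prop :=
  exists N : nat, forall i : 'I_n, in_ideal G ('X_i ^+ N * p).

(* Proj(S/I) is reduced iff the saturation of I is a radical ideal. *)
Definition proj_reduced n (G : {mpoly k[n]} -> Prop) : Prop :=
  forall (p : {mpoly k[n]}) (m : nat),
    in_saturation G (p ^+ m) -> in_saturation G p.

Definition hilb_fun n (G : {mpoly k[n]} -> Prop) (d h : nat) : Prop :=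
  exists s : 'I_h -> {mpoly k[n]},
    (forall i, s i \is d.-homog) /\
    (forall c : 'I_h -> k,
        in_ideal G (\sum_(i < h) c i *: s i) -> forall i, c i = 0) /\
    (forall p : {mpoly k[n]}, p \is d.-homog ->
        exists c : 'I_h -> k, in_ideal G (p - \sum_(i < h) c i *: s i)).

(* The degree of Proj(S/I): (dim)! times the leading coefficient of the
   Hilbert polynomial, dim being the degree of the Hilbert polynomial. *)
Definition proj_degree n (G : {mpoly k[n]} -> Prop) (e : nat) : Prop :=
  exists (hp : {poly rat}) (d0 : nat),
    (forall d, (d0 <= d)%N ->
       exists h, hilb_fun G d h /\ h%:R = hp.[d%:R]) /\
    ((size hp).-1`!)%:R * lead_coef hp = e%:R.

End LineScheme.

(* Main.v *)
(** The line L spanned by u and v lies on the scheme when the matrix M(u, v) has a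
    nonzero kernel vector (w, w'), i.e. when the tensor u w + v w' of rank at most two
    satisfies the relations dual to those of the algebra.  Solving these equations
    gives a union of curves in P^5: with A, ..., F = M34, M24, M23, M14, M13, M12 and
    Q = a A^2 + a C^2 - 2 A C + D^2 + F^2 + 2 B^2, they are two plane cubics (in A, C, E
    and in D, E, F), two curves of degree four in P^3 (in A, B, E, F and in A, C, D, F), and
    two unions of a line and a conic (in B, C, F and in A, B, D).  The forms A F - B E + C D,
    A Q - C E^2, F Q - D E^2, B E Q and the eight monomials A B C, A D E, B C D, B C E,
    B D E, B D F, C D E, C E F vanish on them, and the products of the cubics with each
    variable are combinations of the 45 quartics.  Rewriting with these forms reduces
    every form of degree d > 4, modulo the ideal, to a combination of 20 d - 20 standard
    monomials; and a combination of standard monomials which vanishes on all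
    components is zero, as one sees by restricting it to one component after
    another.  So in degrees above 4 the ideal is the ideal of all forms vanishing on
    the curves, whence both claims. *)
From Stdlib Require Import BinInt Ring_polynom InitialRing.
Require Import Defs.
From HB Require Import structures.
From mathcomp Require Import all_boot all_order all_algebra.
From mathcomp Require Import separable mpoly ring zify ssrZ.
Import GRing.Theory.
Local Open Scope ring_scope.

Set Implicit Arguments.
Unset Strict Implicit.
Unset Printing Implicit Defensive.

(** * Reflection of polynomial identities and determinants *)

Notation pexpr := (PExpr Z).

(** One expression with integer coefficients is read in several rings: the coordinate ring of P^5,
    the ring of the u_i and v_i, and, by computation, over Z. Variables are numbered from 1. *)
Definition peval (R : comNzRingType) (l : seq R) (e : pexpr) : R :=
  PEeval 0 1 +%R *%R (fun x y => x - y) -%R (fun z => (int_of_Z z)%:~R)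
    id (fun x n => x ^+ BinNat.N.to_nat n) l e.

Fixpoint psubst (s : seq pexpr) (e : pexpr) : pexpr :=
  match e with
  | PEX j => BinList.nth (@PEO Z) j s
  | PEadd x y => PEadd (psubst s x) (psubst s y)
  | PEsub x y => PEsub (psubst s x) (psubst s y)
  | PEmul x y => PEmul (psubst s x) (psubst s y)
  | PEopp x => PEopp (psubst s x)
  | PEpow x n => PEpow (psubst s x) n
  | _ => e
  end.

Lemma jump_map (A B : Type) (f : A -> B) j l :
  BinList.jump j (map f l) = map f (BinList.jump j l).
Proof.
have tlE s : List.tl (map f s) = map f (List.tl s) by case: s.
by elim: j l => [j IHj|j IHj|] l /=; rewrite ?tlE ?IHj.
Qed.

Lemma binnth_map (A B : Type) (f : A -> B) d j l :
  BinList.nth (f d) j (map f l) = f (BinList.nth d j l).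
Proof.
have tlE s : List.tl (map f s) = map f (List.tl s) by case: s.
by elim: j l => [j IHj|j IHj|] l /=; rewrite ?tlE ?jump_map ?IHj //; case: l.
Qed.

Lemma rmorph_peval (R S : comNzRingType) (f : {rmorphism R -> S}) l e :
  f (peval l e) = peval (map f l) e.
Proof.
rewrite /peval; elim: e => /= [||c|j|x IHx y IHy|x IHx y IHy|x IHx y IHy|x IHx|x IHx n].
- exact: rmorph0.
- exact: rmorph1.
- exact: rmorph_int.
- rewrite -(binnth_map f 0); congr BinList.nth; exact: rmorph0.
- by rewrite rmorphD IHx IHy.
- by rewrite rmorphB IHx IHy.
- by rewrite rmorphM IHx IHy.
- by rewrite rmorphN IHx.
- by rewrite rmorphXn IHx.
Qed.

Lemma peval_subst (R : comNzRingType) (l : seq R) s e :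
  peval l (psubst s e) = peval (map (peval l) s) e.
Proof.
rewrite /peval; elim: e => /= [||c|j|x IHx y IHy|x IHx y IHy|x IHx y IHy|x IHx|x IHx n] //;
  rewrite ?IHx ?IHy //.
exact: esym (binnth_map (peval l) (@PEO Z) j s).
Qed.

Definition peqb (x y : pexpr) : bool :=
  let nf := norm_subst Z0 (Zpos xH) Z.add Z.mul Z.sub Z.opp Z.eqb
              (triv_div Z0 (Zpos xH) Z.eqb) 0 [::] in
  Peq Z.eqb (nf x) (nf y).

(** Soundness of the normalisation behind [ring], with an empty list of rewriting hypotheses. *)
Lemma peqbP (R : comNzRingType) (l : seq R) x y :
  peqb x y -> peval l x = peval l y.
Proof.
by move=> xy; apply: (@Internals.Rcorrect R 0 l [::] x y I xy).
Qed.

Definition del0 (M : seq (seq pexpr)) i :=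
  [seq behead r | r <- take i M ++ drop i.+1 M].

(* Laplace expansion along the first column; the entries [PEO] are skipped, as
   the minors below are sparse. *)
Fixpoint pdet n (M : seq (seq pexpr)) : pexpr :=
  if n is n'.+1 then
    foldr (fun i acc =>
      let x := head (@PEO Z) (nth [::] M i) in
      if x is PEO then acc else
      let y := PEmul x (pdet n' (del0 M i)) in
      PEadd (if odd i then PEopp y else y) acc) (@PEO Z) (iota 0 n)
  else @PEI Z.

Lemma det_pdet (R : comNzRingType) (l : seq R) n M : size M = n ->
  \det (\matrix_(i < n, j < n) peval l (nth (@PEO Z) (nth [::] M i) j)) =
  peval l (pdet n M).
Proof.
elim: n M => [|n IHn] M szM; first by rewrite det_mx00.
rewrite (expand_det_col _ ord0) [pdet _ _]/=.
set G := fun (i : nat) (acc : pexpr) => _.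
pose t i := (-1) ^+ i * peval l (head (@PEO Z) (nth [::] M i)) *
             peval l (pdet n (del0 M i)).
(* A skipped entry [PEO] would contribute a zero term, so the fold is the full alternating sum along
   the first column. *)
have -> : peval l (G 0 (foldr G (@PEO Z) (iota 1 n))) = \sum_(i < n.+1) t i.
  rewrite -(big_mkord xpredT t) /index_iota subn0.
  rewrite -[G 0 _]/(foldr G (@PEO Z) (iota 0 n.+1)).
  elim: (iota 0 n.+1) => [|i s IHs]; first by rewrite big_nil.
  rewrite big_cons -IHs /= {1}/G /t.
  have F x y z : peval l (PEadd (if odd i then PEopp (PEmul x y) else PEmul x y) z) =
      (-1) ^+ i * peval l x * peval l y + peval l z.
    rewrite /peval /= -signr_odd -mulrA.
    by case: (odd i) => /=; rewrite ?mulN1r ?mul1r.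
  case: (head _ _) => [||c|j|x y|x y|x y|x|x y]; rewrite ?F //.
  by rewrite [peval l PEO]/peval /= mulr0 mul0r add0r.
apply: eq_bigr => i _; rewrite /t mxE nth0 /cofactor mulrCA addn0 -mulrA.
congr (_ * (_ * _)); rewrite -IHn; last first.
  by rewrite size_map size_cat size_take size_drop szM ltn_ord subSS subnKC // -ltnS.
congr (\det _); apply/matrixP => i' j'; rewrite !mxE /del0.
have sz : (i' < size (take i M ++ drop i.+1 M))%N.
  by rewrite size_cat size_take size_drop szM ltn_ord subSS subnKC // -ltnS.
rewrite (nth_map [::]) // nth_behead nth_cat size_take szM ltn_ord.
rewrite [nat_of_ord (lift ord0 j')]/= /bump leq0n add1n.
congr (peval l (nth _ _ _)); rewrite /= /bump.
case: ltnP => [lt_i'i | le_ii']; first by rewrite nth_take // leqNgt lt_i'i.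
by rewrite nth_drop ?le_ii' addSn subnKC.
Qed.

(** * The 45 quartics *)

Declare Scope pexpr_scope.
Delimit Scope pexpr_scope with pexpr.
Bind Scope pexpr_scope with PExpr.
Local Notation "x + y" := (PEadd x y) : pexpr_scope.
Local Notation "x - y" := (PEsub x y) : pexpr_scope.
Local Notation "x * y" := (PEmul x y) : pexpr_scope.
Local Notation "- x" := (PEopp x) : pexpr_scope.
Local Notation "0" := (@PEO Z) : pexpr_scope.
Local Notation "1" := (@PEI Z) : pexpr_scope.
Local Notation "2" := (PEc (Zpos 2)) : pexpr_scope.
Local Notation "4" := (PEc (Zpos 4)) : pexpr_scope.
Local Notation "8" := (PEc (Zpos 8)) : pexpr_scope.

(* Variable 1 is the parameter of the algebra.  In the quartics the variables
   A, ..., F are M34, M24, M23, M14, M13, M12, that is N12, - N13, N14, N23, - N24, N34. *)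
Section Tables.
Local Open Scope pexpr_scope.

Let a := @PEX Z 1.
Let A := @PEX Z 2.
Let B := @PEX Z 3.
Let C := @PEX Z 4.
Let D := @PEX Z 5.
Let E := @PEX Z 6.
Let F := @PEX Z 7.

Definition quartics : seq (seq pexpr) :=
  [:: [:: a*A*D*E*F + 2*A*E*F*F - 2*a*B*D*E*E - 2*B*D*F*F - 2*B*E*E*F - a*C*E*F*F;
        a*A*D*E*E + 2*A*E*E*F + 2*B*D*E*F - 2*B*E*E*E - a*C*E*E*F;
        2*B*D*E*E + a*B*E*E*F - a*A*D*D*E - 2*A*D*E*F - a*A*E*F*F - 2*B*D*D*F;
        2*B*E*E*F + a*C*E*F*F - a*A*D*E*F - 2*A*E*F*F - 2*B*D*F*F;
        2*A*B*E*F - 2*B*B*E*E;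
        a*A*B*E*E + 2*A*B*F*F + 2*A*C*E*F - a*A*A*E*F - 2*B*B*E*F - 2*B*C*E*E - a*C*C*E*F;
        2*B*B*E*E - a*A*B*D*E - 2*A*B*E*F - 2*B*B*D*F - a*B*C*E*F;
        a*A*A*D*E + 2*A*A*E*F + 2*A*B*D*F + 2*a*B*C*E*E - 2*A*B*E*E - a*A*C*E*F;
        a*A*A*D*E + 2*A*A*E*F + 4*B*B*D*E - 2*A*B*D*F - 2*A*B*E*E - a*A*C*E*F];
    [:: a*D*E*E*E - a*a*A*B*E*E - 2*a*A*B*F*F - a*D*D*E*F - a*E*F*F*F;
        a*a*A*A*D*F + 2*a*A*A*F*F + a*D*D*D*F + a*D*F*F*F - a*a*A*B*D*E -
          2*a*A*B*E*F - a*a*A*C*F*F - a*D*D*E*E;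
        a*a*A*A*F*F + 2*a*a*B*B*E*E + 2*a*B*B*F*F + 2*a*B*C*E*F + a*a*C*C*F*F +
          a*D*D*F*F + a*F*F*F*F - 2*a*a*A*B*E*F - 2*a*A*C*F*F - a*D*E*E*F;
        a*A*B*C*F + A*E*F*F - B*D*F*F - B*E*E*F;
        a*B*D*E*F + a*B*E*E*E - a*a*A*B*C*E - a*A*E*E*F;
        a*a*A*A*B*F + a*B*D*D*F - a*a*A*B*B*E - 2*a*A*B*C*F - a*B*D*E*E - a*C*E*F*F;
        a*a*A*A*B*E + 2*a*A*A*C*F + a*A*D*E*E + a*B*E*F*F + a*C*E*E*F - a*a*A*A*A*F
          - a*a*A*C*C*F - a*A*D*D*F - a*A*F*F*F;
        a*A*D*E*E - a*a*A*A*B*E - 2*a*A*B*B*F - 2*a*B*D*D*E - a*B*E*F*F];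
    [:: a*a*A*A*D*E + 2*a*A*A*E*F + 2*a*A*B*D*F - 2*a*A*B*E*E - a*a*A*C*E*F;
        a*a*A*A*E*F + 2*a*A*B*F*F + 2*a*B*C*E*E + a*a*C*C*E*F - a*a*A*B*E*E -
          2*a*A*C*E*F - 2*a*B*B*E*F;
        a*A*B*C*E + A*E*E*F + B*D*E*F - B*E*E*E;
        2*a*A*B*C*F + a*C*E*F*F - a*A*D*E*F;
        a*a*A*A*B*E + 2*a*A*B*B*F + a*B*E*F*F - 2*a*A*B*C*E - a*C*E*E*F;
        2*a*A*A*C*E + a*C*E*E*E - a*a*A*A*A*E - 2*a*A*A*B*F - a*a*A*C*C*E - a*B*E*E*F;
        2*a*A*A*B*F + a*A*D*D*E + a*A*E*F*F - 2*a*A*B*B*E - a*B*E*E*F];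
    [:: a*a*A*B*D*E + 2*a*A*B*E*F + 2*a*B*B*D*F - 2*a*B*B*E*E - a*a*B*C*E*F;
        a*A*B*B*E + B*D*E*E - a*A*A*B*F - A*D*E*F - B*D*D*F;
        a*a*A*A*A*F + 2*a*A*B*C*E + a*a*A*C*C*F + a*A*D*D*F + a*A*F*F*F -
          a*a*A*A*B*E - 2*a*A*A*C*F - a*B*E*F*F;
        a*a*A*B*C*F + a*B*E*E*F - a*A*E*F*F - a*B*D*F*F;
        a*A*E*E*F + a*B*D*E*F - a*a*A*B*C*E - a*B*E*E*E;
        2*a*A*A*B*E + a*a*A*A*C*F + a*B*D*E*F - a*a*A*A*A*D - 2*a*A*A*A*F -
          2*a*A*B*B*D - a*A*D*D*D - a*A*D*F*F];
    [:: a*A*B*C*F + B*E*E*F - A*E*F*F - 2*a*B*B*C*E - B*D*F*F;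
        a*a*A*B*C*E + 2*a*A*C*C*F + a*A*D*F*F - a*a*A*A*C*F - 2*a*B*B*C*F -
          2*a*B*C*C*E - a*a*C*C*C*F - a*C*F*F*F;
        2*a*B*B*C*E + a*C*E*F*F - a*a*A*B*B*E - 2*a*B*B*B*F - a*a*B*C*C*F - a*B*F*F*F;
        a*a*A*A*B*E + 2*a*A*B*B*F + 2*a*a*B*C*C*E + a*B*E*F*F - 2*a*A*B*C*E - a*C*E*E*F;
        a*a*A*A*B*E + 2*a*A*A*C*F + 4*a*B*B*B*E + a*B*E*F*F - a*a*A*A*A*F -
          4*a*A*B*B*F - 2*a*A*B*C*E - a*a*A*C*C*F - a*A*D*D*F - a*A*F*F*F];
    [:: B*B*E*F + B*C*E*E - a*A*B*C*C - A*B*F*F - A*C*E*F;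
        A*B*E*F + B*B*D*F - a*A*B*B*C - B*B*E*E;
        a*A*A*B*C + A*B*E*E - A*A*E*F - A*B*D*F;
        A*B*D*F + A*B*E*E - a*A*A*B*C - A*A*E*F - 2*B*B*D*E];
    [:: a*a*A*A*B*C - 2*a*A*B*C*C - a*A*B*D*F - a*C*C*E*F;
        2*a*A*A*C*C + a*A*A*D*F + a*B*C*E*F + a*C*C*E*E - a*a*A*A*A*C - a*a*A*C*C*C
          - a*A*C*F*F;
        a*A*B*D*E - 2*a*A*B*B*C - a*B*C*E*F];
    [:: a*A*C*E*F + a*B*B*E*F - a*a*A*B*C*C - a*A*B*F*F - a*B*C*E*E;
        2*a*A*A*B*C + a*A*C*E*F - a*a*A*A*A*B - 2*a*A*B*B*B - a*A*B*D*D - a*B*B*E*F];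
    [:: a*a*A*A*A*A + 2*a*A*A*B*B + a*a*A*A*C*C + a*A*A*D*D + a*A*A*F*F + 2*a*B*B*E*E -
          2*a*A*A*A*C - 2*a*A*B*E*F - a*A*C*E*E]].

(* The quartic of the minor omitting the rows [i < j]. *)
Definition quartic i j := nth 0 (nth [::] quartics i) (j - i.+1).

Let Q := a*A*A + a*C*C - 2*A*C + D*D + F*F + 2*B*B.
Let gA := A * Q - C*E*E.
Let gF := F * Q - D*E*E.

Let t (c : pexpr) (i j : nat) := (c, i, j).

(* Each entry [(h, s)] certifies that 4 a^2 h is, modulo the Pluecker relation,
   the combination of the quartics with the coefficients listed in [s]. *)
Definition certificates : seq (pexpr * seq (pexpr * nat * nat)) :=
  [:: (gA * A, [:: t (4*a*a) 0 5; t (4*a) 8 9]);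
    (gA * B, [:: t (- (4*a*a)) 5 6; t (- (4*a)) 7 9]);
    (gA * C, [:: t (- (4*a)) 0 7; t (- (8*a)) 5 7; t (- (4*a)) 6 8]);
    (gA * D, [:: t (4*a*a) 2 5; t (- (4*a)) 3 9]);
    (gA * E, [:: t (- (4*a)) 0 3; t (- (4*a)) 2 8; t (8*a) 3 5]);
    (gA * F, [:: t (4*a) 2 7; t (4*a) 3 6]);
    (gF * A, [:: t (- (4*a)) 0 2; t (4*a) 2 5; t (4*a) 2 7; t (4*a) 3 6; t 4 3 8]);
    (gF * B, [:: t (4*a) 0 4; t (- (4*a*a)) 3 5; t (- (4)) 3 7; t (- (4*a)) 4 5; t (-
      (4*a)) 4 7]);
    (gF * C, [:: t (4*a*a) 2 5; t 4 2 7; t (- (4*a)) 4 6; t (- (4)) 4 8]);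
    (gF * D, [:: t (- (4*a*a)) 0 5; t (- (4*a*a)) 0 7; t (4*a) 1 3]);
    (gF * E, [:: t (- (4*a*a)) 0 6; t (- (4*a)) 0 8; t (- (4*a)) 1 2; t 4 2 3]);
    (gF * F, [:: t (4*a*a*a) 0 5; t (4*a) 0 7; t (4*a) 1 4; t 4 3 4]);
    (A * B * C * A, [:: t (- (a)) 0 9; t 1 2 3; t (2*a) 5 8; t (- (2*a)) 5 9]);
    (A * B * C * B, [:: t 1 3 4; t (- (2*a)) 5 7; t (- (a)) 6 9]);
    (A * B * C * C, [:: t (- (a)) 0 6; t (- (1)) 2 4; t (- (2*a)) 5 6; t (- (2)) 7 8]);
    (A * B * C * D, [:: t (- (a)) 0 3; t (- (a)) 2 9; t (2*a) 3 5]);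
    (A * B * C * E, [:: t (2*a) 2 5; t (- (2)) 3 8]);
    (A * B * C * F, [:: t (- (a)) 0 4; t a 2 6; t 2 3 7]);
    (A * D * E * A, [:: t (2*a) 0 8; t (2*a) 0 9; t (- (2*a*a)) 5 6; t (4*a) 5 8; t
      (4*a) 5 9; t (2*a) 7 8]);
    (A * D * E * B, [:: t (- (2*a)) 0 7; t (- (4*a)) 5 7; t (2*a) 6 9]);
    (A * D * E * C, [:: t (2*a) 0 6; t (4*a) 5 6; t (2*a*a) 5 8; t (- (2*a)) 6 7]);
    (A * D * E * D, [:: t (- (2*a)) 0 3; t (- (2*a*a)) 1 5; t (2*a) 2 9; t (4*a) 3 5; t
      (2*a) 3 7]);
    (A * D * E * E, [:: t (2*a) 0 2; t (2*a) 1 8; t (- (4*a)) 2 5; t (2*a) 3 6]);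
    (A * D * E * F, [:: t (- (2*a)) 1 7; t (- (2*a)) 2 6; t (- (2*a*a)) 3 5]);
    (B * C * D * A, [:: t (- (a)) 0 3; t (- (a)) 2 9; t (2*a) 3 5]);
    (B * C * D * B, [:: t a 3 6; t a 4 9]);
    (B * C * D * C, [:: t a 0 4; t (- (a)) 2 6; t (- (2*a)) 4 5]);
    (B * C * D * D, [:: t (a*a) 0 9; t (- (a)) 2 3]);
    (B * C * D * E, [:: t (- (2*a*a)) 0 5]);
    (B * C * D * F, [:: t (- (a*a)) 0 6; t (- (a)) 2 4]);
    (B * C * E * A, [:: t (2*a) 2 5; t (- (2)) 3 8]);
    (B * C * E * B, [:: t 2 3 7; t (- (2*a)) 4 5]);
    (B * C * E * C, [:: t (- (2)) 2 7; t 2 4 8]);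
    (B * C * E * D, [:: t (- (2*a*a)) 0 5]);
    (B * C * E * E, [:: t (2*a) 0 8; t (- (2)) 2 3]);
    (B * C * E * F, [:: t (- (2*a)) 0 7; t (- (2)) 3 4]);
    (B * D * E * A, [:: t (- (2*a)) 0 7; t (- (4*a)) 5 7; t (2*a) 6 9]);
    (B * D * E * B, [:: t (2*a) 0 6; t (4*a) 5 6; t (- (2*a*a)) 5 9; t (- (2*a)) 6 7]);
    (B * D * E * C, [:: t (- (2*a*a)) 0 5]);
    (B * D * E * D, [:: t (2*a) 0 2; t (- (2*a)) 1 9; t (- (4*a)) 2 5; t (- (2*a)) 2 7]);
    (B * D * E * E, [:: t (- (2*a)) 0 1; t (4*a) 1 5; t (- (2*a)) 2 6]);
    (B * D * E * F, [:: t (2*a) 1 6; t (2*a*a) 2 5]);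
    (B * D * F * A, [:: t (2*a) 0 6; t (- (a*a)) 0 9; t a 2 3; t (4*a) 5 6; t (-
      (2*a*a)) 5 9; t (- (2*a)) 6 7]);
    (B * D * F * B, [:: t (- (2*a*a)) 0 5; t a 3 4; t (2*a*a) 5 7; t (- (a*a)) 6 9]);
    (B * D * F * C, [:: t (- (a*a)) 0 6; t (- (a)) 2 4]);
    (B * D * F * D, [:: t (- (2*a)) 0 1; t (- (a*a)) 0 3; t (4*a) 1 5; t (2*a) 1 7; t (-
      (a*a)) 2 9]);
    (B * D * F * E, [:: t (2*a) 1 6; t (2*a*a) 2 5]);
    (B * D * F * F, [:: t (- (a*a)) 0 4; t (- (2*a*a)) 1 5; t (a*a) 2 6]);
    (C * D * E * A, [:: t (2*a) 0 6; t (4*a) 5 6; t (2*a*a) 5 8; t (- (2*a)) 6 7]);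
    (C * D * E * B, [:: t (- (2*a*a)) 0 5]);
    (C * D * E * C, [:: t (2*a*a) 5 6; t (- (2*a)) 7 8]);
    (C * D * E * D, [:: t (- (2*a)) 0 1; t (4*a) 1 5; t (2*a) 1 7; t (2*a*a) 3 5]);
    (C * D * E * E, [:: t (2*a) 1 6; t (- (2*a)) 3 8]);
    (C * D * E * F, [:: t (- (2*a*a)) 1 5; t (2*a) 3 7]);
    (C * E * F * A, [:: t (2*a) 0 8; t (- (2)) 2 3; t (- (2*a*a)) 5 6; t (2*a) 7 8]);
    (C * E * F * B, [:: t (- (2*a)) 0 7; t (- (2)) 3 4]);
    (C * E * F * C, [:: t 2 2 4; t (2*a*a) 5 8; t (- (2*a)) 6 7; t 4 7 8]);
    (C * E * F * D, [:: t (- (2*a*a)) 1 5; t (2*a) 3 7]);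
    (C * E * F * E, [:: t (- (2*a)) 0 2; t (2*a) 1 8; t (2*a) 3 6; t 4 3 8]);
    (C * E * F * F, [:: t (2*a) 0 4; t (- (2*a)) 1 7; t (- (2*a*a)) 3 5; t (- (4)) 3 7]);
    (B * E * Q, [:: t (2*a) 1 8; t (- (2*a)) 1 9; t (- (4*a)) 2 5; t (4*a) 3 6; t 4 3 8;
      t (2*a) 4 8; t (2*a) 4 9])].

Let u i := @PEX Z (Pos.of_nat i.+1).
Let v i := @PEX Z (Pos.of_nat (i + 5)).
Let N i j := u i * v j - u j * v i.

Definition plucker_subst : seq pexpr :=
  [:: a; N 1 2; - N 1 3; N 1 4; N 2 3; - N 2 4; N 3 4].

Definition Mrows_pexpr : seq (seq pexpr) :=
  [:: [:: a * u 1; u 4; u 3; 0; a * v 1; v 4; v 3; 0];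
      [:: 0; u 1; 0; 0; 0; v 1; 0; 0];
      [:: - u 3; 0; u 1; 0; - v 3; 0; v 1; 0];
      [:: - u 4; 0; 0; u 1; - v 4; 0; 0; v 1];
      [:: u 2; 0; 0; 0; v 2; 0; 0; 0];
      [:: 0; a * u 2 - 2 * u 4; - (2 * u 3); a * u 4;
          0; a * v 2 - 2 * v 4; - (2 * v 3); a * v 4];
      [:: 0; u 3; u 2; 0; 0; v 3; v 2; 0];
      [:: 0; - u 4; 0; u 2; 0; - v 4; 0; v 2];
      [:: 0; 0; 0; u 3; 0; 0; 0; v 3];
      [:: 0; 0; u 4; 0; 0; 0; v 4; 0] ].

Definition rows_but i j := [seq r <- iota 0 10 | (r != i) && (r != j)].

(** A sufficient test for homogeneity in the coordinates: the parameter counts as a constant, and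
    [None] only means that no degree was found. *)
Fixpoint pdeg (e : pexpr) : option nat :=
  match e with
  | PEI | PEc _ | PEX 1%positive => Some 0%N
  | PEX (2 | 3 | 4 | 5 | 6 | 7)%positive => Some 1%N
  | x + y | x - y => if pdeg x == pdeg y then pdeg x else None
  | x * y => if (pdeg x, pdeg y) is (Some d, Some d') then Some (d + d')%N else None
  | - x => pdeg x
  | _ => None
  end.

Definition pairs10 : seq (nat * nat) :=
  [seq (i, j) | i <- iota 0 10, j <- iota i.+1 (9 - i)].

Definition quartic_ok ij :=
  (pdeg (quartic ij.1 ij.2) == Some 4%N) &&
  peqb (psubst plucker_subst (quartic ij.1 ij.2))
       (pdet 8 [seq nth [::] Mrows_pexpr r | r <- rows_but ij.1 ij.2]).

Lemma quartics_ok : all quartic_ok pairs10.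
Proof. by vm_compute. Qed.

(** The multiple of the Pluecker relation is not recorded: it suffices that the residue is a quartic
    form which vanishes under the Pluecker substitution. *)
Definition residue (c : pexpr * seq (pexpr * nat * nat)) : pexpr :=
  foldr (fun t acc => acc - t.1.1 * quartic t.1.2 t.2) (4 * a * a * c.1) c.2.

Definition certificate_ok (c : pexpr * seq (pexpr * nat * nat)) :=
  [&& pdeg (residue c) == Some 4%N, all (fun t => (t.1.2, t.2) \in pairs10) c.2
    & peqb (psubst plucker_subst (residue c)) 0].

Lemma certificates_ok : all certificate_ok certificates.
Proof. by vm_compute. Qed.

End Tables.

(** * Forms in the ideal *)

Section InIdeal.
Variables (k : fieldType) (n : nat) (G : {mpoly k[n]} -> Prop).

Lemma in_ideal0 : in_ideal G 0.
Proof. by exists [::]; rewrite big_nil. Qed.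

Lemma in_ideal_gen p : G p -> in_ideal G p.
Proof.
move=> Gp; exists [:: (1, p)]; rewrite big_seq1 mul1r; split=> // x.
by rewrite inE => /eqP->.
Qed.

Lemma in_idealD p q : in_ideal G p -> in_ideal G q -> in_ideal G (p + q).
Proof.
move=> [s [Gs ->]] [s' [Gs' ->]]; exists (s ++ s'); rewrite big_cat; split=> // x.
by rewrite mem_cat => /orP[/Gs|/Gs'].
Qed.

Lemma in_idealM r p : in_ideal G p -> in_ideal G (r * p).
Proof.
move=> [s [Gs ->]]; exists [seq (r * x.1, x.2) | x <- s]; split.
  by move=> _ /mapP[x xs ->] /=; apply: Gs.
by rewrite big_map mulr_sumr; apply: eq_bigr => x _; rewrite mulrA.
Qed.

Lemma in_idealN p : in_ideal G p -> in_ideal G (- p).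
Proof. by move=> Ip; rewrite -mulN1r; apply: in_idealM. Qed.

Lemma in_idealB p q : in_ideal G p -> in_ideal G q -> in_ideal G (p - q).
Proof. by move=> Ip Iq; apply/in_idealD/in_idealN. Qed.

Lemma in_idealZ c p : in_ideal G p -> in_ideal G (c *: p).
Proof. by rewrite -mul_mpolyC; apply: in_idealM. Qed.

Lemma in_ideal_sum (I : eqType) (r : seq I) (F : I -> {mpoly k[n]}) :
  (forall i, i \in r -> in_ideal G (F i)) -> in_ideal G (\sum_(i <- r) F i).
Proof.
elim: r => [|i r IHr] IF; first by rewrite big_nil; apply: in_ideal0.
rewrite big_cons; apply: in_idealD; first by apply/IF/mem_head.
by apply: IHr => j jr; apply: IF; rewrite inE jr orbT.
Qed.

End InIdeal.

(** * The quartics as generators, and the certified forms in the ideal *)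

Section LineIdeal.
Variables (k : fieldType) (a : k).

Definition coords : seq {mpoly k[6]} :=
  [:: a%:MP; M34 k; M24 k; M23 k; M14 k; M13 k; M12 k].

Definition uvs : seq {mpoly k[8]} :=
  [:: a%:MP; uu k 1; uu k 2; uu k 3; uu k 4; vv k 1; vv k 2; vv k 3; vv k 4].

Local Notation I := (in_ideal (line_gens a)).
Local Notation S p := (p \mPo sigmaN k).

Lemma pdeg_homog e d : pdeg e = Some d -> peval coords e \is d.-homog.
Proof.
have homX i : MM k i \is 1.-homog by rewrite dhomogX /= mdeg1.
have homC (c : k) : (c%:MP : {mpoly k[6]}) \is 0.-homog.
  by rewrite -[c%:MP]mulr1 mul_mpolyC; apply/dhomogZ/dhomog1.
elim: e d => [||c|j|x IHx y IHy|x IHx y IHy|x IHx y IHy|x IHx|x IHx n] d //=.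
- by case=> <-; rewrite dhomog1.
- by case=> <-; rewrite /peval /= -(rmorph_int (@mpolyC 6 k)) homC.
- by case: j => [[[]|[]|]|[[]|[]|]|] //= [<-]; rewrite ?homX ?homC.
- by case: eqP => // eq_xy dx; apply: dhomogD; [exact: IHx | apply: IHy; rewrite -eq_xy].
- by case: eqP => // eq_xy dx; apply: rpredB; [exact: IHx | apply: IHy; rewrite -eq_xy].
- case: (pdeg x) IHx => // dx IHx; case: (pdeg y) IHy => // dy IHy [<-].
  by apply: dhomogM; [exact: IHx | exact: IHy].
- by move=> dx; rewrite dhomogN; exact: IHx.
Qed.

Lemma comp_coords e :
  S (peval coords e) = peval uvs (psubst plucker_subst e).
Proof.
rewrite peval_subst rmorph_peval; congr peval; rewrite /=.
rewrite comp_mpolyC /M34 /M24 /M23 /M14 /M13 /M12 /MM !comp_mpolyXU.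
by rewrite /= !inordK.
Qed.

Lemma Mrows_peval : map (map (peval uvs)) Mrows_pexpr = Mrows a.
Proof. by rewrite /Mrows (rmorph_nat (@mpolyC 8 k) 2). Qed.

Lemma rows_but_ok : all (fun ij : nat * nat => let s := rows_but ij.1 ij.2 in
  [&& sorted ltn s, size s == 8 & all (fun r => r < 10)%N s]) pairs10.
Proof. by vm_compute. Qed.

Lemma quarticP i j : (i, j) \in pairs10 ->
  peval coords (quartic i j) \is 4.-homog /\
  exists f : 'I_8 -> 'I_10, incr_sel f /\
    S (peval coords (quartic i j)) = minor8 a f.
Proof.
move=> ij10; have /andP[/eqP/pdeg_homog dq /peqbP minor] := allP quartics_ok _ ij10.
split=> //; set s := rows_but i j in minor.
have [ss sz s10] : [/\ sorted ltn s, size s = 8 & all (fun r => r < 10)%N s].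
  by have /and3P[? /eqP ? ?] := allP rows_but_ok _ ij10.
(* The selection enumerates the eight rows other than i and j; they are below 10, so [inord] loses
   nothing. *)
exists (fun r => inord (nth 0 s r)); split.
  move=> r r' lt_rr'; have lt_s t : (t < 8)%N -> (nth 0 s t < 10)%N.
    by move=> lt_t; apply: (allP s10); rewrite mem_nth ?sz.
  rewrite !inordK ?lt_s //.
  by apply: (sorted_ltn_nth ltn_trans 0 ss); rewrite ?inE ?sz.
rewrite comp_coords minor -det_pdet ?size_map ?sz //; congr (\det _).
apply/matrixP => r c; rewrite !mxE.
have lt_sr : (nth 0 s r < size Mrows_pexpr)%N.
  by apply: (allP s10); rewrite mem_nth ?sz.
rewrite -Mrows_peval inordK // (nth_map 0) ?sz // (nth_map [::]) //.
rewrite (nth_map (@PEO Z)) //.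
have sz8 : all (fun r => size r == 8) Mrows_pexpr by [].
by rewrite (eqP (all_nthP [::] sz8 _ lt_sr)).
Qed.

Hypotheses (a_neq0 : a != 0) (two_neq0 : 2%:R != 0 :> k).

(* Adding to a form in the kernel of the substitution any form associated with
   a minor gives another form associated with the same minor. *)
Lemma comp_eq0_in_ideal h : h \is 4.-homog -> S h = 0 -> I h.
Proof.
move=> dh Sh; have [//|dq [f [incr_f Sq]]] := @quarticP 0 1.
set q := peval _ _ in dq Sq.
rewrite -(addrK q h); apply: in_idealB; apply: in_ideal_gen; right.
  split; first exact: dhomogD.
  by exists f; split=> //; rewrite comp_mpolyD Sh add0r.
by split=> //; exists f.
Qed.

Lemma quartic_in_ideal i j : (i, j) \in pairs10 -> I (peval coords (quartic i j)).
Proof. by move=> /quarticP[dq Sq]; apply: in_ideal_gen; right. Qed.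

Lemma certificate_in_ideal i : (i < size certificates)%N ->
  I (peval coords (nth (@PEI Z, [::]) certificates i).1).
Proof.
set c := nth _ _ _; move=> /(all_nthP (@PEI Z, [::]) certificates_ok).
rewrite -/c => /and3P[/eqP/pdeg_homog dr c10 /peqbP r0].
have Ir : I (peval coords (residue c)).
  apply: comp_eq0_in_ideal => //; rewrite comp_coords r0 //.
have a4 : 4%:R * a * a != 0 by rewrite (natrM _ 2 2) !mulf_neq0.
have: I ((4%:R * a * a) *: peval coords c.1).
  have -> : (4%:R * a * a) *: peval coords c.1 =
      peval coords (4 * PEX Z 1 * PEX Z 1 * c.1)%pexpr.
    rewrite -mul_mpolyC !mpolyCM (rmorph_nat (@mpolyC 6 k) 4) //.
  (* Adding back the multiples of the quartics one at a time stays in the ideal and ends at 4 a^2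
     times the certified form. *)
  move: c10 Ir; rewrite /residue; elim: c.2 => [//|t s IHs] /= /andP[t10 s10].
  rewrite {1}/peval /= => Ir; apply: IHs => //.
  by rewrite -[X in I X](subrK (peval coords t.1.1 * peval coords (quartic t.1.2 t.2)));
    apply/in_idealD/in_idealM/quartic_in_ideal.
by move/(in_idealZ (4%:R * a * a)^-1); rewrite scalerA mulVf // scale1r.
Qed.

End LineIdeal.

(** * Vanishing on the line scheme *)

Section Vanishing.
Variables (k : fieldType) (a : k).

(* The ten rows of the matrix, as linear conditions on the tensor [R] = u w + v w'. *)
Definition relations (R : nat -> nat -> k) : Prop :=
  let r (i j : nat) := R i j in
  [/\ a * r 1 1 + r 4 2 + r 3 3 = 0, r 1 2 = 0, r 1 3 - r 3 1 = 0,
      r 1 4 - r 4 1 = 0 & r 2 1 = 0] /\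
  [/\ a * r 2 2 - 2 * r 4 2 - 2 * r 3 3 + a * r 4 4 = 0, r 3 2 + r 2 3 = 0,
      r 2 4 - r 4 2 = 0, r 3 4 = 0 & r 4 3 = 0].

(** Indices start at 1, and a shorter list stands for a vector padded with zeros; the points on the
    curves below are written this way. *)
Definition of4 (s : seq k) i := nth 0 s i.-1.

Definition pluckers (u v : seq k) (i : 'I_6) : k :=
  let N i j := of4 u i * of4 v j - of4 u j * of4 v i in
  nth 0 [:: N 3 4; - N 2 4; N 2 3; N 1 4; - N 1 3; N 1 2] i.

Definition on_line_scheme (u v w w' : seq k) : Prop :=
  relations (fun i j => of4 u i * of4 w j + of4 v i * of4 w' j) /\
  has (fun j => (of4 w j != 0) || (of4 w' j != 0)) (iota 1 4).

Let pt (u v : seq k) (i : 'I_8) := if (i < 4)%N then nth 0 u i else nth 0 v (i - 4).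

Lemma pt_uu u v i : (0 < i <= 4)%N -> (uu k i).@[pt u v] = of4 u i.
Proof.
case: i => // i /= i4; rewrite mevalXU /pt inordK ?i4 //.
exact: leq_trans i4 _.
Qed.

Lemma pt_vv u v i : (0 < i <= 4)%N -> (vv k i).@[pt u v] = of4 v i.
Proof.
case: i => // i /= i4; rewrite mevalXU /pt addn3 inordK //=.
by rewrite -addn4 addnK.
Qed.

Lemma meval_sigmaN u v i : (tnth (sigmaN k) i).@[pt u v] = pluckers u v i.
Proof.
case: i => [[|[|[|[|[|[|i]]]]]] lt_i] //=;
  rewrite /Nuv (tnth_nth 0) /= ?mevalN mevalB !mevalM !pt_uu // !pt_vv //.
Qed.

(** The nonzero vector (w, w') is annihilated by all ten rows evaluated at (u, v), so any eight rows
    form a singular matrix. *)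
Lemma minor8_meval u v w w' f : on_line_scheme u v w w' ->
  (minor8 a f).@[pt u v] = 0.
Proof.
move=> [[[r1 r2 r3 r4 r5] [r6 r7 r8 r9 r10]] nz].
(* [det0P] speaks of left kernels, hence the transposition. *)
rewrite /minor8 -det_map_mx -det_tr; apply/eqP/det0P.
exists (\row_j nth 0 (map (of4 w) (iota 1 4) ++ map (of4 w') (iota 1 4)) j).
  apply/eqP => /rowP w0.
  have {}w0 i (lt_i8 : (i < 8)%N) :
      nth 0 (map (of4 w) (iota 1 4) ++ map (of4 w') (iota 1 4)) i = 0.
    by have := w0 (Ordinal lt_i8); rewrite !mxE.
  move: nz; rewrite /= (w0 0 isT : of4 w 1 = 0) (w0 1 isT : of4 w 2 = 0).
  rewrite (w0 2 isT : of4 w 3 = 0) (w0 3 isT : of4 w 4 = 0).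
  rewrite (w0 4 isT : of4 w' 1 = 0) (w0 5 isT : of4 w' 2 = 0).
  by rewrite (w0 6 isT : of4 w' 3 = 0) (w0 7 isT : of4 w' 4 = 0) eqxx.
apply/rowP => i; rewrite !mxE.
under eq_bigr do rewrite !mxE.
case: (f i) => [[|[|[|[|[|[|[|[|[|[|r]]]]]]]]]] lt_r] //=;
  rewrite !big_ord_recl big_ord0 /=;
  rewrite ?(mevalN, mevalB, mevalD, mevalM, meval0, mevalC, mulr0, addr0, add0r);
  rewrite ?pt_uu // ?pt_vv //.
- by rewrite -[RHS]r1; ring.
- by rewrite -[RHS]r2; ring.
- by rewrite -[RHS]r3; ring.
- by rewrite -[RHS]r4; ring.
- by rewrite -[RHS]r5; ring.
- by rewrite -[RHS]r6; ring.
- by rewrite -[RHS]r7; ring.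
- by rewrite -[RHS]r8; ring.
- by rewrite -[RHS]r9; ring.
- by rewrite -[RHS]r10; ring.
Qed.

Lemma in_ideal_vanish p u v w w' : on_line_scheme u v w w' ->
  in_ideal (line_gens a) p -> p.@[pluckers u v] = 0.
Proof.
move=> uvw [s [Gs ->]]; rewrite raddf_sum /= big_seq big1 // => x /Gs Gx.
rewrite mevalM [X in _ * X](_ : _ = 0) ?mulr0 //.
case: Gx => [->|[_ [f [_ Sx]]]].
  rewrite /Pform /M12 /M13 /M14 /M23 /M24 /M34 /MM.
  rewrite mevalD mevalB !mevalM !mevalXU /pluckers !inordK //=; ring.
rewrite -(minor8_meval f uvw) -Sx comp_mpoly_meval.
by apply: meval_eq => i; rewrite meval_sigmaN.
Qed.

Lemma of4_scale c s i : of4 (map ( *%R c) s) i = c * of4 s i.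
Proof.
rewrite /of4; case: (ltnP i.-1 (size s)) => lt_is; first by rewrite (nth_map 0).
by rewrite !nth_default ?size_map ?mulr0.
Qed.

(** The tensor (c u) w + v (c w') is c times u w + v w'. With [pluckers_scale] this makes the set of
    points a cone. *)
Lemma on_line_scheme_scale c u v w w' : c != 0 ->
  on_line_scheme u v w w' -> on_line_scheme (map ( *%R c) u) v w (map ( *%R c) w').
Proof.
move=> c0 [[[r1 r2 r3 r4 r5] [r6 r7 r8 r9 r10]] nz].
split; last first.
  rewrite (eq_has (a2 := fun j => (of4 w j != 0) || (of4 w' j != 0))) // => j.
  by rewrite /= of4_scale mulf_eq0 (negPf c0).
rewrite /relations /= !of4_scale.
split; split.
all: rewrite -[RHS](mulr0 c).
- by rewrite -r1; ring.
- by rewrite -r2; ring.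
- by rewrite -r3; ring.
- by rewrite -r4; ring.
- by rewrite -r5; ring.
- by rewrite -r6; ring.
- by rewrite -r7; ring.
- by rewrite -r8; ring.
- by rewrite -r9; ring.
- by rewrite -r10; ring.
Qed.

Lemma pluckers_scale c u v i : pluckers (map ( *%R c) u) v i = c * pluckers u v i.
Proof.
rewrite /pluckers !of4_scale.
case: i => [[|[|[|[|[|[|i]]]]]] lt_i] //=; ring.
Qed.

End Vanishing.

(** * Reduction to standard monomials *)

Section Monomials.
Implicit Types m : 'X_{1..6}.

(** The arguments are the exponents of M34, ..., M12; the tuple is reversed because M12 is variable
    0. *)
Definition mon (A B C D E F : nat) : 'X_{1..6} := [multinom [tuple F; E; D; C; B; A]].

Lemma mon_surj m : exists A B C D E F, m = mon A B C D E F.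
Proof.
exists (m (inord 5)), (m (inord 4)), (m (inord 3)), (m (inord 2)), (m (inord 1)), (m (inord 0)).
apply/mnmP => i; rewrite multinomE (tnth_nth 0%N) -[in LHS](inord_val i).
by case: i => [[|[|[|[|[|[|i]]]]]] lt_i].
Qed.

Lemma mdeg_mon A B C D E F : mdeg (mon A B C D E F) = (F + E + D + C + B + A)%N.
Proof.
by rewrite mdegE !big_ord_recr big_ord0 /= !multinomE !(tnth_nth 0%N).
Qed.

Lemma mon_inj A B C D E F A' B' C' D' E' F' :
  mon A B C D E F = mon A' B' C' D' E' F' ->
  [/\ A = A', B = B' & C = C'] /\ [/\ D = D', E = E' & F = F'].
Proof. by move=> /(congr1 (fun m => tval (multinom_val m))) /= [-> -> -> -> -> ->]. Qed.

Lemma le_mon A B C D E F A' B' C' D' E' F' :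
  (mon A B C D E F <= mon A' B' C' D' E' F')%MM =
  [&& A <= A', B <= B', C <= C', D <= D', E <= E' & F <= F']%N.
Proof.
apply/mnm_lepP/idP => [le|/and5P[? ? ? ? /andP[? ?]] i].
  have := (le (inord 0), le (inord 1), le (inord 2), le (inord 3), le (inord 4), le (inord 5)).
  by rewrite !multinomE !(tnth_nth 0%N) !inordK //= => -[[[[[-> ->] ->] ->] ->] ->].
by rewrite !multinomE !(tnth_nth 0%N); case: i => [[|[|[|[|[|[|i]]]]]] lt_i].
Qed.

Lemma mpolyX_mon (k : fieldType) A B C D E F :
  'X_[mon A B C D E F] =
  M34 k ^+ A * M24 k ^+ B * M23 k ^+ C * M14 k ^+ D * M13 k ^+ E * M12 k ^+ F.
Proof.
rewrite /M34 /M24 /M23 /M14 /M13 /M12 /MM !mpolyXn -!mpolyXD; congr 'X_[_].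
apply/mnmP => i; rewrite !mnmDE !mulmnE !mnm1E multinomE (tnth_nth 0%N).
rewrite -!val_eqE /= !inordK //.
by case: i => [[|[|[|[|[|[|i]]]]]] lt_i]; rewrite //= ?(muln0, mul0n, muln1, mul1n, addn0, add0n).
Qed.

Lemma meval_mon (k : fieldType) (x : 'I_6 -> k) A B C D E F :
  'X_[mon A B C D E F].@[x] =
  x (inord 5) ^+ A * x (inord 4) ^+ B * x (inord 3) ^+ C * x (inord 2) ^+ D *
  x (inord 1) ^+ E * x (inord 0) ^+ F.
Proof.
by rewrite mpolyX_mon !mevalM !rmorphXn /= !mevalXU.
Qed.

(* The leading monomials of [rules]. *)
Definition leads : seq 'X_{1..6} :=
  [:: mon 1 0 0 0 0 1; mon 0 0 0 0 0 3; mon 3 0 0 0 0 0; mon 2 1 0 0 1 0; mon 2 0 1 1 0 0;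
      mon 1 1 1 0 0 0; mon 1 0 0 1 1 0; mon 0 1 1 1 0 0; mon 0 1 1 0 1 0; mon 0 1 0 1 1 0;
      mon 0 1 0 1 0 1; mon 0 0 1 1 1 0; mon 0 0 1 0 1 1].

Definition standard m := ~~ has (fun l => l <= m)%MM leads.

(* The last four arguments tell which exponents of M24, M23, M14, M13 are positive. *)
Definition standard_support A F (b c d e : bool) :=
  ~~ [|| (0 < A) && (0 < F), 2 < F, 2 < A, [&& 1 < A, b & e], [&& 1 < A, c & d],
      [&& 0 < A, b & c], [&& 0 < A, d & e], [&& b, c & d], [&& b, c & e], [&& b, d & e],
      [&& b, d & 0 < F], [&& c, d & e] | [&& c, e & 0 < F]]%N.

Lemma standard_mon A B C D E F : standard (mon A B C D E F) =
  standard_support A F (0 < B)%N (0 < C)%N (0 < D)%N (0 < E)%N.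
Proof. by rewrite /standard /= !le_mon /= ?andbT ?orbF. Qed.

Lemma standard_le A B C D E F : standard (mon A B C D E F) ->
  [/\ A <= 2, F <= 2 & A * F = 0]%N.
Proof.
rewrite standard_mon /standard_support !negb_or -!leqNgt => /andP[AF] /andP[F2] /andP[A2 _].
by split=> //; case: A F AF {A2 F2} => [|A] [|F]; rewrite ?muln0 ?mul0n.
Qed.

(** Used for the two quartic curves: there a standard monomial divisible by A^2 already lives on a
    plane cubic or a conic. *)
Lemma standard_A2 A B C D E F : standard (mon A B C D E F) -> (1 < A)%N ->
  [/\ F = 0, B = 0 \/ E = 0 & C = 0 \/ D = 0]%N.
Proof.
case: A => [|[|A]] //.
rewrite standard_mon /standard_support !negb_or => /andP[F0] /andP[_] /andP[_] /andP[BE] /andP[CD _] _.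
split; first by case: F F0.
  by case: B E BE => [|B] [|E] //; [left | left | right].
by case: C D CD => [|C] [|D] //; [left | left | right].
Qed.

(** The measure that makes the rewriting by [rules] terminate. *)
Definition weight m := (m (inord 5) * 2 + m (inord 0))%N.

Lemma weightD m m' : weight (m + m')%MM = (weight m + weight m')%N.
Proof. by rewrite /weight !mnmDE mulnDl addnACA. Qed.

Lemma weight_mon A B C D E F : weight (mon A B C D E F) = (A * 2 + F)%N.
Proof. by rewrite /weight !multinomE !(tnth_nth 0%N) !inordK. Qed.

End Monomials.

(** * Every form of degree above 4 reduces to standard monomials *)

Section Spanning.
Variables (k : fieldType) (a : k).
Hypotheses (a_neq0 : a != 0) (two_neq0 : 2%:R != 0 :> k).

Local Notation I := (in_ideal (line_gens a)).
Local Notation A := (M34 k).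
Local Notation B := (M24 k).
Local Notation C := (M23 k).
Local Notation D := (M14 k).
Local Notation E := (M13 k).
Local Notation F := (M12 k).

(** The cubic forms are certified only after multiplication by each variable. This suffices wherever
    a cofactor of positive degree is available. *)
Definition almost_in p := forall i, I ('X_i * p).

Lemma almost_inD p q : almost_in p -> almost_in q -> almost_in (p + q).
Proof. by move=> Kp Kq i; rewrite mulrDr; apply: in_idealD. Qed.

Lemma almost_inB p q : almost_in p -> almost_in q -> almost_in (p - q).
Proof. by move=> Kp Kq i; rewrite mulrBr; apply: in_idealB. Qed.

Lemma almost_inM r p : almost_in p -> almost_in (r * p).
Proof. by move=> Kp i; rewrite mulrCA; apply: in_idealM. Qed.

Lemma in_ideal_almost p : I p -> almost_in p.
Proof. by move=> Ip i; apply: in_idealM. Qed.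

Lemma almost_in_mulX p m : almost_in p -> (0 < mdeg m)%N -> I ('X_[m] * p).
Proof.
move=> Kp; rewrite lt0n mdeg_eq0 => m0.
have [i mi] : exists i, m i != 0%N.
  apply/existsP; apply: contraR m0; rewrite negb_exists => /forallP m0.
  by apply/eqP/mnmP => i; rewrite mnm0E; apply/eqP; rewrite -[_ == _]negbK.
have le_im : (U_(i) <= m)%MM.
  apply/mnm_lepP => j; rewrite mnm1E; case: eqP => // <-; by rewrite lt0n.
by rewrite -(submK le_im) mpolyXD -mulrA; apply: in_idealM.
Qed.

Lemma letterE (i : 'I_6) : 'X_i = nth 0 [:: F; E; D; C; B; A] i :> {mpoly k[6]}.
Proof.
rewrite -[i in LHS]inord_val -/(MM k i).
by case: i => [[|[|[|[|[|[|i]]]]]] lt_i].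
Qed.

Let Q := a%:MP * A * A + a%:MP * C * C - 2%:R * A * C + D * D + F * F + 2%:R * B * B.

Let cert n := @certificate_in_ideal k a a_neq0 two_neq0 n.

(** Certificates 6 n to 6 n + 5 treat the n-th form times A, ..., F in turn, whereas ['X_i] runs
    from F = M12 up to A = M34. *)
Ltac by_certificates n :=
  let i := fresh in case=> [[|[|[|[|[|[|i]]]]]] lt_i];
  rewrite letterE mulrC //;
  [ exact: (@cert (6 * n + 5)%N isT) | exact: (@cert (6 * n + 4)%N isT)
  | exact: (@cert (6 * n + 3)%N isT) | exact: (@cert (6 * n + 2)%N isT)
  | exact: (@cert (6 * n + 1)%N isT) | exact: (@cert (6 * n + 0)%N isT)].

Lemma almost_in_gA : almost_in (A * Q - C * E * E).
Proof. by_certificates 0%N. Qed.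

Lemma almost_in_gF : almost_in (F * Q - D * E * E).
Proof. by_certificates 1%N. Qed.

Lemma almost_in_ABC : almost_in (A * B * C).
Proof. by_certificates 2%N. Qed.

Lemma almost_in_ADE : almost_in (A * D * E).
Proof. by_certificates 3%N. Qed.

Lemma almost_in_BCD : almost_in (B * C * D).
Proof. by_certificates 4%N. Qed.

Lemma almost_in_BCE : almost_in (B * C * E).
Proof. by_certificates 5%N. Qed.

Lemma almost_in_BDE : almost_in (B * D * E).
Proof. by_certificates 6%N. Qed.

Lemma almost_in_BDF : almost_in (B * D * F).
Proof. by_certificates 7%N. Qed.

Lemma almost_in_CDE : almost_in (C * D * E).
Proof. by_certificates 8%N. Qed.

Lemma almost_in_CEF : almost_in (C * E * F).
Proof. by_certificates 9%N. Qed.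

Lemma almost_in_BEQ : almost_in (B * E * Q).
Proof. by apply: in_ideal_almost; exact: (@cert 60 isT). Qed.

Lemma almost_in_P : almost_in (A * F - B * E + C * D).
Proof.
apply/in_ideal_almost/in_ideal_gen; left.
by rewrite /Pform; ring.
Qed.

(** The first three rules solve the Pluecker relation, F Q - D E^2 and A Q - C E^2 for A F, F^3 and
    A^3; the next two come from B E Q and C D Q; the others send a monomial to zero. *)
Definition rules : seq ('X_{1..6} * seq (k * 'X_{1..6})) :=
  [:: (mon 1 0 0 0 0 1, [:: (1, mon 0 1 0 0 1 0); (-1, mon 0 0 1 1 0 0)]);
      (mon 0 0 0 0 0 3,
        [:: (- a, mon 1 1 0 0 1 0); (a, mon 1 0 1 1 0 0); (- a, mon 0 0 2 0 0 1);
            (- 2%:R, mon 0 0 2 1 0 0); (-1, mon 0 0 0 2 0 1);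
            (- 2%:R, mon 0 2 0 0 0 1); (1, mon 0 0 0 1 2 0)]);
      (mon 3 0 0 0 0 0,
        [:: (-1, mon 1 0 2 0 0 0); (2%:R / a, mon 2 0 1 0 0 0);
            (- a^-1, mon 1 0 0 2 0 0); (- (2%:R / a), mon 1 2 0 0 0 0);
            (a^-1, mon 0 0 1 0 2 0); (- a^-1, mon 0 1 0 0 1 1); (a^-1, mon 0 0 1 1 0 1)]);
      (mon 2 1 0 0 1 0, [:: (- a^-1, mon 0 1 0 0 1 2); (- (2%:R / a), mon 0 3 0 0 1 0)]);
      (mon 2 0 1 1 0 0,
        [:: (-1, mon 0 0 3 1 0 0); (2%:R / a, mon 1 0 2 1 0 0);
            (- a^-1, mon 0 0 1 3 0 0); (- a^-1, mon 0 0 1 1 0 2)]);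
      (mon 1 1 1 0 0 0, [::]); (mon 1 0 0 1 1 0, [::]); (mon 0 1 1 1 0 0, [::]);
      (mon 0 1 1 0 1 0, [::]); (mon 0 1 0 1 1 0, [::]); (mon 0 1 0 1 0 1, [::]);
      (mon 0 0 1 1 1 0, [::]); (mon 0 0 1 0 1 1, [::])].

Lemma rules_decrease r t : r \in rules -> t \in r.2 ->
  (weight t.2 < weight r.1)%N && (mdeg t.2 == mdeg r.1).
Proof.
suff /allP H : all (fun r : 'X_{1..6} * seq (k * 'X_{1..6}) =>
    all (fun t => (weight t.2 < weight r.1)%N && (mdeg t.2 == mdeg r.1)) r.2) rules.
  by move=> /H/allP; apply.
by rewrite /= !weight_mon !mdeg_mon.
Qed.

Lemma rules_almost_in r : r \in rules ->
  almost_in ('X_[r.1] - \sum_(t <- r.2) t.1 *: 'X_[t.2]).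
Proof.
have aK : a%:MP_[6] * a^-1%:MP = 1 by rewrite -mpolyCM mulfV.
have c2 : (2%:R : k)%:MP_[6] = 2%:R by rewrite (rmorph_nat (@mpolyC 6 k)).
set b := a^-1%:MP in aK.
rewrite !inE; do !case/orP=> [/eqP->|]; last move/eqP=> -> /=;
  rewrite /= ?big_cons ?big_nil -?mul_mpolyC ?mpolyCM ?mpolyCN ?mpolyCM ?c2 -?/b;
  rewrite ?mpolyX_mon ?expr0 ?expr1 ?mulr1 ?mul1r ?subr0.
- have := almost_in_P; congr almost_in; ring.
- have := almost_inD (almost_inB almost_in_gF (almost_inM (a%:MP * A - 2%:R * C) almost_in_P))
    (almost_inM 2%:R almost_in_BCE).
  by congr almost_in; rewrite /Q; ring.
- have := almost_inB (almost_inM b almost_in_gA) (almost_inM (b * F) almost_in_P).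
  by congr almost_in; rewrite /Q; ring: aK.
- have := almost_inB (almost_inM b almost_in_BEQ)
    (almost_inD (almost_inM (C - 2%:R * b * A) almost_in_BCE) (almost_inM (b * D) almost_in_BDE)).
  by congr almost_in; rewrite /Q; ring: aK.
(* With P = A F - B E + C D, the form C D Q equals Q P + B E Q - F (A Q - C E^2) - E (C E F). *)
- have CDQ := almost_inB (almost_inD (almost_inM Q almost_in_P) almost_in_BEQ)
    (almost_inD (almost_inM F almost_in_gA) (almost_inM E almost_in_CEF)).
  have := almost_inB (almost_inM b CDQ) (almost_inM (2%:R * b * B) almost_in_BCD).
  by congr almost_in; rewrite /Q; ring: aK.
- exact: almost_in_ABC.
- exact: almost_in_ADE.
- exact: almost_in_BCD.
- exact: almost_in_BCE.
- exact: almost_in_BDE.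
- exact: almost_in_BDF.
- exact: almost_in_CDE.
- exact: almost_in_CEF.
Qed.

Definition reducible d (p : {mpoly k[6]}) := exists r : {mpoly k[6]},
  [/\ r \is d.-homog, all standard (msupp r) & I (p - r)].

Lemma reducible0 d : reducible d 0.
Proof. by exists 0; rewrite dhomog0 msupp0 subr0; split=> //; apply: in_ideal0. Qed.

Lemma reducibleD d p q : reducible d p -> reducible d q -> reducible d (p + q).
Proof.
move=> [r [dr sr Ir]] [r' [dr' sr' Ir']]; exists (r + r'); split.
- exact: dhomogD.
- apply/allP => m /msuppD_le; rewrite mem_cat.
  by case/orP; [apply: (allP sr) | apply: (allP sr')].
- by rewrite opprD addrACA; apply: in_idealD.
Qed.

Lemma reducibleZ d c p : reducible d p -> reducible d (c *: p).
Proof.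
move=> [r [dr sr Ir]]; exists (c *: r); split; first exact: dhomogZ.
  by apply/allP => m /msuppZ_le; apply: (allP sr).
by rewrite -scalerBr; apply: in_idealZ.
Qed.

Lemma reducible_sum d (T : eqType) (s : seq T) (G : T -> {mpoly k[6]}) :
  (forall t, t \in s -> reducible d (G t)) -> reducible d (\sum_(t <- s) G t).
Proof.
elim: s => [|t s IHs] sG; first by rewrite big_nil; apply: reducible0.
rewrite big_cons; apply: reducibleD; first by apply/sG/mem_head.
by apply: IHs => u us; apply: sG; rewrite inE us orbT.
Qed.

Lemma reducible_congr d p q : I (p - q) -> reducible d q -> reducible d p.
Proof.
move=> Ipq [r [dr sr Ir]]; exists r; split=> //.
by rewrite -(subrK q p) -addrA; apply: in_idealD.
Qed.

(** Induction on the weight. A leading monomial has degree at most 4, so its cofactor in m has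
    positive degree, which turns [almost_in] into membership. *)
Lemma mpolyX_reducible d m : (4 < d)%N -> mdeg m = d -> reducible d 'X_[m].
Proof.
move=> d4; have [n] := ubnP (weight m); elim: n m => // n IHn m /ltnSE le_mn dm.
have [std_m|] := boolP (standard m).
  exists 'X_[m]; rewrite dhomogX /= dm eqxx msuppX /= std_m subrr.
  by split=> //; apply: in_ideal0.
rewrite negbK => /hasP[l]; rewrite -[leads]/(map fst rules) => /mapP[r r_rules ->] le_rm.
have degr : (mdeg r.1 <= 4)%N.
  suff /allP : all (fun r : 'X_{1..6} * seq (k * 'X_{1..6}) => mdeg r.1 <= 4)%N rules by apply.
  by rewrite /= !mdeg_mon.
have dm' : (mdeg (m - r.1) + mdeg r.1 = d)%N by rewrite -mdegD submK.
apply: (@reducible_congr _ _ (\sum_(t <- r.2) t.1 *: 'X_[m - r.1 + t.2])).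
  have := almost_in_mulX (rules_almost_in r_rules) (m := m - r.1).
  rewrite mulrBr -mpolyXD submK // mulr_sumr.
  under eq_bigr do rewrite -scalerAr -mpolyXD.
  by apply; rewrite -(ltn_add2r (mdeg r.1)) dm'; apply: leq_ltn_trans d4.
apply: reducible_sum => t tr; apply/reducibleZ/IHn.
  apply: leq_trans le_mn; rewrite -[in X in (_ < X)%N](submK le_rm) !weightD ltn_add2l.
  by have /andP[] := rules_decrease r_rules tr.
by have /andP[_ /eqP dt] := rules_decrease r_rules tr; rewrite mdegD dt.
Qed.

Lemma homog_reducible d p : (4 < d)%N -> p \is d.-homog -> reducible d p.
Proof.
move=> d4 /dhomogP dp; rewrite [p]mpolyE; apply: reducible_sum => m mp.
by apply/reducibleZ/mpolyX_reducible/dp.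
Qed.

End Spanning.

(** * Generic fibres of the components *)

Section GenericFibre.
Variable k : closedFieldType.

Lemma poly_vanish (p : {poly k}) : (forall x, p.[x] = 0) -> p = 0.
Proof.
move=> p0; apply/eqP/negPn/negP => /closed_nonrootP[x].
by rewrite /root p0 eqxx.
Qed.

(* For all but finitely many [e] the polynomial [n + e^2 m] is separable, hence
   has more roots than the degree of [\sum_(i < s) (c i).[e] *: 'X^i] allows. *)
Lemma generic_fibre (n m : {poly k}) s (c : nat -> {poly k}) :
    size n = s.+1 -> (size m <= s)%N -> coprimep n m ->
    n^`() * m - n * m^`() != 0 ->
    (forall e t, e != 0 -> t != 0 -> n.[t] + e ^+ 2 * m.[t] = 0 ->
      \sum_(i < s) (c i).[e] * t ^+ i = 0) ->
  forall i, (i < s)%N -> c i = 0.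
Proof.
move=> sz_n sz_m co_nm W0 vanish i lt_is.
(* [W] is the Wronskian of n and m; [fib t] is n(t) + e^2 m(t) as a polynomial in e. *)
pose W := n^`() * m - n * m^`(); have [rs defW] := closed_field_poly_normal W.
pose fib t : {poly k} := n.[t]%:P + m.[t] *: 'X^2.
have fib0 t : fib t != 0.
  apply/eqP => /polyP fib0; have := fib0 0; have := fib0 2.
  rewrite !coefD !coefC !coefZ !coefXn /= mulr0 mulr1 add0r addr0 => mt nt.
  have : m.[t] != 0 by apply: (coprimep_root co_nm); rewrite /root nt.
  by rewrite mt eqxx.
have fibE t e : (fib t).[e] = n.[t] + e ^+ 2 * m.[t].
  by rewrite hornerD hornerC hornerZ hornerXn mulrC.
(* The excluded e are zero, those with t = 0 in the fibre, and those with a root of [W] in the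
   fibre. *)
pose bad := 'X * fib 0 * \prod_(t <- rs) fib t.
have bad0 : bad != 0.
  rewrite !mulf_neq0 ?polyX_eq0 // prodf_seq_neq0.
  by apply/allP => t _ /=.
suff /eqP : bad * c i = 0 by rewrite mulf_eq0 (negPf bad0) => /eqP.
apply: poly_vanish => e; rewrite hornerM.
have [-> | bad_e] := eqVneq bad.[e] 0; first by rewrite mul0r.
have e0 : e != 0 by apply: contraNneq bad_e => ->; rewrite !hornerM hornerX !mul0r.
pose p := n + e ^+ 2 *: m; have sz_p : size p = s.+1.
  by rewrite size_polyDl ?sz_n // (leq_ltn_trans (size_scale_leq _ _)).
have [zs def_p] := closed_field_poly_normal p.
have p0 : p != 0 by rewrite -size_poly_eq0 sz_p.
have sep_p : separable_poly p.
  rewrite unlock; apply: Pdiv.ClosedField.root_coprimep => z pz0.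
  apply: contraNneq bad_e => p'z0.
  (* At a multiple root n = - e^2 m and n' = - e^2 m', so [W] vanishes there. *)
  have nz : n.[z] = - (e ^+ 2 * m.[z]).
    by apply/eqP; rewrite -addr_eq0 -hornerZ -hornerD.
  have n'z : n^`().[z] = - (e ^+ 2 * m^`().[z]).
    by apply/eqP; rewrite -addr_eq0 -hornerZ -hornerD -derivZ -derivD p'z0.
  have z_rs : z \in rs.
    rewrite -root_prod_XsubC -(rootZ _ _ (_ : lead_coef W != 0)) ?lead_coef_eq0 //.
    by rewrite -defW /root hornerD hornerN !hornerM nz n'z; apply/eqP; ring.
  by rewrite /bad (big_rem z z_rs) /= !hornerM (fibE z) nz addNr mul0r mulr0.
have uniq_zs : uniq zs.
  rewrite -separable_prod_XsubC -(@eqp_separable _ p) // def_p.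
  by rewrite eqp_scale ?lead_coef_eq0.
have root_zs z : z \in zs -> n.[z] + e ^+ 2 * m.[z] = 0.
  move=> z_zs; rewrite -hornerZ -hornerD -/p; apply/eqP.
  rewrite -[_ == 0]/(root p z) def_p rootZ ?lead_coef_eq0 //.
  by rewrite root_prod_XsubC.
(* A polynomial with at most s coefficients which vanishes at the s distinct roots of p. *)
pose q := \poly_(i < s) (c i).[e].
have q0 : q = 0.
  apply/eqP/negPn/negP => q0.
  have sz_zs : size zs = s.
    by apply: succn_inj; rewrite -sz_p def_p size_scale ?lead_coef_eq0 // size_prod_XsubC.
  suff : (size zs < size q)%N by rewrite sz_zs ltnNge size_poly.
  apply: max_poly_roots => //; apply/allP => z /root_zs root_z.
  rewrite /root horner_poly; apply/eqP/vanish => //.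
  apply: contraNneq bad_e => z0; rewrite z0 in root_z.
  by rewrite /bad !hornerM (fibE 0) root_z mulr0 mul0r.
have := congr1 (fun q : {poly k} => q`_i) q0; rewrite coef_poly lt_is coef0 => ->.
by rewrite mulr0.
Qed.

End GenericFibre.

(** Group the terms by their power of t. Since (eps, tau) is injective, each g x is then a single
    coefficient of one of the resulting polynomials in e. *)
Lemma generic_fibre_monomials (k : closedFieldType) (T : eqType) (n m : {poly k}) s
    (ms : seq T) (g : T -> k) (eps tau : T -> nat) :
    size n = s.+1 -> (size m <= s)%N -> coprimep n m ->
    n^`() * m - n * m^`() != 0 ->
    uniq ms -> {in ms, forall x, (tau x < s)%N} ->
    {in ms &, injective (fun x => (eps x, tau x))} ->
    (forall e t, e != 0 -> t != 0 -> n.[t] + e ^+ 2 * m.[t] = 0 ->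
      \sum_(x <- ms) g x * e ^+ eps x * t ^+ tau x = 0) ->
  {in ms, forall x, g x = 0}.
Proof.
move=> sz_n sz_m co_nm W0 uniq_ms lt_tau inj vanish x x_ms.
pose c i : {poly k} := \sum_(y <- ms | tau y == i) g y *: 'X^(eps y).
have c0 : c (tau x) = 0.
  apply: (generic_fibre sz_n sz_m co_nm W0) (lt_tau x x_ms) => e t e0 t0 et.
  rewrite -[RHS](vanish e t e0 t0 et).
  transitivity (\sum_(i < s) \sum_(y <- ms | tau y == i) g y * e ^+ eps y * t ^+ tau y).
    apply: eq_bigr => i _; rewrite horner_sum mulr_suml; apply: eq_bigr => y /eqP->.
    by rewrite hornerZ hornerXn.
  rewrite (exchange_big_dep xpredT) //= [LHS]big_seq [RHS]big_seq.
  apply: eq_bigr => y /lt_tau lt_y.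
  rewrite (bigD1 (Ordinal lt_y)) //= big1 ?addr0 // => i /andP[/eqP eq_i].
  by rewrite -val_eqE /= -eq_i eqxx.
have := congr1 (fun q : {poly k} => q`_(eps x)) c0.
rewrite coef0 coef_sum -big_filter (bigD1_seq x) ?filter_uniq ?mem_filter ?eqxx //=.
rewrite coefZ coefXn eqxx mulr1 big_seq_cond big1 ?addr0 // => y /andP[].
rewrite mem_filter => /andP[/eqP tau_y y_ms] neq_yx.
rewrite coefZ coefXn; case: eqP => [eps_y|_]; last by rewrite mulr0.
by case/eqP: neq_yx; apply: inj => //; rewrite tau_y eps_y.
Qed.

(** * Independence of the standard monomials *)

Section PolySeq.
Variable R : comNzRingType.

Lemma horner_Poly_cons (c : R) q x : (Poly (c :: q)).[x] = (Poly q).[x] * x + c.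
Proof. by rewrite /= cons_poly_def !hornerE. Qed.

Lemma horner_deriv_Poly_cons (c : R) q x :
  (Poly (c :: q))^`().[x] = (Poly q)^`().[x] * x + (Poly q).[x].
Proof. by rewrite /= cons_poly_def derivD derivM derivX derivC addr0 mulr1 !hornerE. Qed.

Lemma horner_Poly_nil (x : R) : (Poly [::]).[x] = 0.
Proof. exact: horner0. Qed.

Lemma horner_deriv_Poly_nil (x : R) : (Poly [::])^`().[x] = 0.
Proof. by rewrite deriv0 horner0. Qed.

Definition horner_PolyE :=
  (horner_Poly_cons, horner_deriv_Poly_cons, horner_Poly_nil, horner_deriv_Poly_nil).

End PolySeq.

Section Independence.
Variables (k : closedFieldType) (a : k).
Hypotheses (a_neq0 : a != 0) (a_neq1 : a != 1) (two_neq0 : 2%:R != 0 :> k).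

(** A nonzero Pluecker coordinate makes u and v span a line, that is, a point of P^5. *)
Definition vanishing (p : {mpoly k[6]}) := forall u v w w' : seq k,
  on_line_scheme a u v w w' -> (exists i, pluckers u v i != 0) ->
  p.@[pluckers u v] = 0.

Variables (d : nat) (p : {mpoly k[6]}).
Hypotheses (dp : p \is d.-homog) (std_p : all standard (msupp p)) (vp : vanishing p).

(** On the component, p becomes a sum over its monomials in P alone. The powers t^r and t^r' clear
    denominators or divide out a common factor, and kappa absorbs signs. *)
Lemma vanishing_component (n m : {poly k}) s (P : pred 'X_{1..6})
    (eps tau : 'X_{1..6} -> nat) (kappa : 'X_{1..6} -> k) r r'
    (u v w w' : k -> k -> seq k) :
    size n = s.+1 -> (size m <= s)%N -> coprimep n m ->
    n^`() * m - n * m^`() != 0 ->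
    (forall e t, e != 0 -> t != 0 -> n.[t] + e ^+ 2 * m.[t] = 0 ->
      on_line_scheme a (u e t) (v e t) (w e t) (w' e t) /\
      exists i, pluckers (u e t) (v e t) i != 0) ->
    (forall x e t, x \in msupp p -> e != 0 -> t != 0 ->
      'X_[x].@[pluckers (u e t) (v e t)] * t ^+ r =
      if P x then kappa x * e ^+ eps x * t ^+ (tau x + r') else 0) ->
    (forall x, x \in msupp p -> P x -> (tau x < s)%N && (kappa x != 0)) ->
    (forall x y, x \in msupp p -> y \in msupp p -> P x -> P y ->
      eps x = eps y -> tau x = tau y -> x = y) ->
  forall x, P x -> p@_x = 0.
Proof.
move=> sz_n sz_m co_nm W0 uv X_uv tau_s inj x Px.
have [//|] := eqVneq p@_x 0; rewrite -mcoeff_msupp => xp.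
have /andP[_ kx0] := tau_s x xp Px.
have : x \in filter P (msupp p) by rewrite mem_filter Px.
suff E : {in filter P (msupp p), forall x, p@_x * kappa x = 0}.
  by move/E/eqP; rewrite mulf_eq0 (negPf kx0) orbF => /eqP.
apply: (generic_fibre_monomials (eps := eps) (tau := tau) sz_n sz_m co_nm W0).
- exact/filter_uniq/msupp_uniq.
- by move=> y; rewrite mem_filter => /andP[Py yp]; have /andP[] := tau_s y yp Py.
- move=> y z; rewrite !mem_filter => /andP[Py yp] /andP[Pz zp] [].
  exact: inj.
move=> e t e0 t0 et; have [ls nz] := uv e t e0 t0 et.
apply: (mulIf (expf_neq0 r' t0)); rewrite mul0r -[RHS](mul0r (t ^+ r)).
rewrite -[X in _ = X * _](vp ls nz) [in RHS](mpolyE p) raddf_sum /= !mulr_suml.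
rewrite big_filter [RHS]big_seq [LHS]big_seq_cond big_mkcondr /=.
apply: eq_bigr => y yp; rewrite mevalZ -[RHS]mulrA X_uv //.
by case: (P y); rewrite ?mulr0 // exprD !mulrA.
Qed.

Lemma msupp_standard A B C D E F : mon A B C D E F \in msupp p ->
  standard (mon A B C D E F) /\ (A + B + C + D + E + F = d)%N.
Proof.
move=> xp; split; first exact: (allP std_p).
by have /dhomogP/(_ _ xp) := dp; rewrite /= mdeg_mon; lia.
Qed.

Lemma mon_exps A B C D E F (x := mon A B C D E F) :
  ((x (inord 5) = A) * (x (inord 4) = B) * (x (inord 3) = C) *
   (x (inord 2) = D) * (x (inord 1) = E) * (x (inord 0) = F))%type.
Proof. by rewrite /x !multinomE !(tnth_nth 0%N) !inordK. Qed.

(* The points of a component are parametrized by [e] and by a root [t] of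
   n + e^2 m; [l] lists their coordinates M12, M13, M14, M23, M24, M34.  There, up to
   the powers t^r and t^r', a monomial in [P] is e^eps t^tau with tau less than
   the degree of n, so that the generic fibre separates these monomials. *)
Lemma component_coef0 (n m : seq k) x0 (P : nat -> nat -> nat -> nat -> nat -> nat -> bool)
    (eps tau : nat -> nat -> nat -> nat -> nat -> nat -> nat)
    (kappa : nat -> nat -> nat -> nat -> nat -> nat -> k) r r'
    (u v w w' l : k -> k -> seq k) i0 :
    last 0 n != 0 -> (size m < size n)%N ->
    (forall x, (Poly n).[x] = 0 -> (Poly m).[x] != 0) ->
    (Poly n)^`().[x0] * (Poly m).[x0] - (Poly n).[x0] * (Poly m)^`().[x0] != 0 ->
    (forall e t, e != 0 -> t != 0 -> (Poly n).[t] + e ^+ 2 * (Poly m).[t] = 0 ->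
      on_line_scheme a (u e t) (v e t) (w e t) (w' e t)) ->
    (forall e t i, e != 0 -> t != 0 -> pluckers (u e t) (v e t) i = nth 0 (l e t) i) ->
    (i0 < 6)%N -> (forall e t, e != 0 -> t != 0 -> nth 0 (l e t) i0 != 0) ->
    (forall A B C D E F e t, mon A B C D E F \in msupp p -> e != 0 -> t != 0 ->
      let c := nth 0 (l e t) in
      c 5 ^+ A * c 4 ^+ B * c 3 ^+ C * c 2 ^+ D * c 1 ^+ E * c 0 ^+ F * t ^+ r =
      if P A B C D E F then
        kappa A B C D E F * e ^+ eps A B C D E F * t ^+ (tau A B C D E F + r') else 0) ->
    (forall A B C D E F, mon A B C D E F \in msupp p -> P A B C D E F ->
      (tau A B C D E F < (size n).-1)%N && (kappa A B C D E F != 0)) ->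
    (forall A B C D E F A' B' C' D' E' F',
       standard (mon A B C D E F) -> standard (mon A' B' C' D' E' F') ->
       P A B C D E F -> P A' B' C' D' E' F' ->
       (A + B + C + D + E + F = A' + B' + C' + D' + E' + F')%N ->
       eps A B C D E F = eps A' B' C' D' E' F' ->
       tau A B C D E F = tau A' B' C' D' E' F' ->
       [/\ A = A', B = B' & C = C'] /\ [/\ D = D', E = E' & F = F']) ->
  forall A B C D E F, P A B C D E F -> p@_(mon A B C D E F) = 0.
Proof.
move=> n0 lt_mn co_nm W0 uv pl lt_i0 l0 l_uv tauP inj A B C D E F PA.
pose on T (G : nat -> nat -> nat -> nat -> nat -> nat -> T) (x : 'X_{1..6}) :=
  G (x (inord 5)) (x (inord 4)) (x (inord 3)) (x (inord 2)) (x (inord 1)) (x (inord 0)).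
have sz_n : size (Poly n) = size n by rewrite (PolyK n0).
apply: (@vanishing_component (Poly n) (Poly m) (size n).-1 (on _ P) (on _ eps) (on _ tau)
  (on _ kappa) r r' u v w w').
- by rewrite sz_n prednK // (leq_ltn_trans _ lt_mn).
- by rewrite (leq_trans (size_Poly _)) // -ltnS prednK // (leq_ltn_trans _ lt_mn).
- apply: Pdiv.ClosedField.root_coprimep => x /eqP; exact: co_nm.
- by apply: contraNneq W0 => W0; rewrite -!hornerM -hornerN -hornerD W0 horner0.
- move=> e t e0 t0 et; split; first exact: uv.
  by exists (Ordinal lt_i0); rewrite pl ?l0.
- move=> x e t xp e0 t0; have [A1 [B1 [C1 [D1 [E1 [F1 def_x]]]]]] := mon_surj x.
  rewrite {}def_x in xp *.
  by rewrite /on !mon_exps meval_mon -l_uv // !pl // !inordK.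
- move=> x; have [A1 [B1 [C1 [D1 [E1 [F1 ->]]]]]] := mon_surj x.
  by rewrite /on !mon_exps; apply: tauP.
- move=> x y; have [A1 [B1 [C1 [D1 [E1 [F1 ->]]]]]] := mon_surj x.
  have [A2 [B2 [C2 [D2 [E2 [F2 ->]]]]]] := mon_surj y.
  move=> /msupp_standard[s1 d1] /msupp_standard[s2 d2]; rewrite /on !mon_exps => P1 P2 e12 t12.
  by have [] := inj _ _ _ _ _ _ _ _ _ _ _ _ s1 s2 P1 P2 (etrans d1 (esym d2)) e12 t12;
    move=> [-> -> ->] [-> -> ->].
- by rewrite /on !mon_exps.
Qed.

(** * Restriction to lines, conics, plane cubics and curves of degree four *)

Ltac case_zero n := case: n => [|n] /=; rewrite ?(mul0r, mulr0, mul1r, mulr1) //.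

Lemma rel_mul (c x y : k) : x = 0 -> y = c * x -> y = 0.
Proof. by move=> -> ->; rewrite mulr0. Qed.

Ltac by_rel H := first [ring | apply: (rel_mul (c := 1) H); ring
  | apply: (rel_mul (c := -1) H); ring | apply: (rel_mul (c := 2%:R) H); ring
  | apply: (rel_mul (c := - a) H); ring].

Ltac by_pluckers :=
  let i := fresh in let lt_i := fresh in
  move=> e t [[|[|[|[|[|[|i]]]]]] lt_i] // e0 t0; rewrite /pluckers /of4 /=; by [ring | field].

Lemma msupp_le A B C D E F : mon A B C D E F \in msupp p ->
  [/\ A <= 2, F <= 2 & A * F = 0]%N.
Proof. by case/msupp_standard=> /standard_le. Qed.

Lemma coefK A B C D E F :
  mon A B C D E F \in msupp p -> p@_(mon A B C D E F) = 0 -> false.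
Proof. by rewrite mcoeff_msupp => /eqP. Qed.

(** The line M23 = 1, M24 = e. Taking n = t - 1 and m = 1 makes t = 1 - e^2 a dummy, and e alone
    separates the monomials. *)
Lemma coef_BC B C : p@_(mon 0 B C 0 0 0) = 0.
Proof.
apply: (@component_coef0 [:: -1; 1] [:: 1] 0
  (fun A B C D E F => [&& A == 0, D == 0, E == 0 & F == 0]%N)
  (fun A B C D E F => B) (fun A B C D E F => 0%N) (fun A B C D E F => 1) 0 0
  (fun e t => [:: 1]) (fun e t => [:: 0; 0; - e; 1])
  (fun e t => [:: 0; 0; - e; 1]) (fun e t => [:: 1])
  (fun e t => [:: 0; 0; 0; 1; e; 0]) 3) => //.
- exact: oner_neq0.
- by move=> x _; rewrite !horner_PolyE mul0r add0r ?oppr_eq0 ?oner_neq0.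
- rewrite !horner_PolyE (_ : _ - _ = 1); last by ring.
  exact: oner_neq0.
- move=> e t e0 t0 et; split; last by rewrite /= /of4 /= oner_neq0 ?orbT.
  by rewrite /relations /of4 /=; split; split; ring.
- by_pluckers.
- by move=> e t e0 t0; exact: oner_neq0.
- move=> {}A {}B {}C {}D {}E {}F e t + e0 t0 /=; rewrite ?expr1n ?expr0n.
  by case_zero A; case_zero D; case_zero E; case_zero F.
- by move=> *; rewrite oner_neq0.
- by move=> A1 B1 C1 D1 E1 F1 A2 B2 C2 D2 E2 F2 _ _ /= *; split; split; lia.
Qed.

(** The same on the line M14 = 1, M24 = e. *)
Lemma coef_BD B D : p@_(mon 0 B 0 D 0 0) = 0.
Proof.
apply: (@component_coef0 [:: -1; 1] [:: 1] 0
  (fun A B C D E F => [&& A == 0, C == 0, E == 0 & F == 0]%N)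
  (fun A B C D E F => B) (fun A B C D E F => 0%N) (fun A B C D E F => 1) 0 0
  (fun e t => [:: - e; 1]) (fun e t => [:: 0; 0; 1])
  (fun e t => [:: 0; 0; 1]) (fun e t => [:: - e; -1])
  (fun e t => [:: 0; 0; 1; 0; e; 0]) 2) => //.
- exact: oner_neq0.
- by move=> x _; rewrite !horner_PolyE mul0r add0r ?oppr_eq0 ?oner_neq0.
- rewrite !horner_PolyE (_ : _ - _ = 1); last by ring.
  exact: oner_neq0.
- move=> e t e0 t0 et; split; last by rewrite /= /of4 /= oner_neq0 ?orbT.
  by rewrite /relations /of4 /=; split; split; ring.
- by_pluckers.
- by move=> e t e0 t0; exact: oner_neq0.
- move=> {}A {}B {}C {}D {}E {}F e t + e0 t0 /=; rewrite ?expr1n ?expr0n.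
  by case_zero A; case_zero C; case_zero E; case_zero F.
- by move=> *; rewrite oner_neq0.
- by move=> A1 B1 C1 D1 E1 F1 A2 B2 C2 D2 E2 F2 _ _ /= *; split; split; lia.
Qed.

(** The conic F^2 + a C^2 + 2 B^2 = 0 with C = 1, B = e, F = t. The line F = 0 has removed the
    monomials without F; dividing by F leaves exponents 0 and 1, below the degree 2 of n. *)
Lemma coef_BCF B C F : p@_(mon 0 B C 0 0 F) = 0.
Proof.
case: F => [|F]; first exact: coef_BC.
apply: (@component_coef0 [:: a; 0; 1] [:: 2%:R] 1
  (fun A B C D E F => [&& A == 0, D == 0, E == 0 & 0 < F]%N)
  (fun A B C D E F => B) (fun A B C D E F => F.-1%N) (fun A B C D E F => 1) 0 1
  (fun e t => [:: 1; 0; t]) (fun e t => [:: 0; 0; - e; 1])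
  (fun e t => [:: - t; 0; a; 2%:R * e]) (fun e t => [:: 2%:R * e; 0; 0; 2%:R * t])
  (fun e t => [:: t; 0; 0; 1; e; 0]) 3) => //.
- exact: oner_neq0.
- by move=> x _; rewrite !horner_PolyE mul0r add0r ?oppr_eq0 ?oner_neq0.
- rewrite !horner_PolyE (_ : _ - _ = 2%:R * 2%:R); last by ring.
  by rewrite mulf_neq0.
- move=> e t e0 t0 et; split; last by rewrite /= /of4 /= mulf_neq0 // ?orbT.
  have H : t ^+ 2 + a + 2%:R * e ^+ 2 = 0 by rewrite -[RHS]et !horner_PolyE; ring.
  by rewrite /relations /of4 /=; split; split; by_rel H.
- by_pluckers.
- by move=> e t e0 t0; exact: oner_neq0.
- move=> {}A {}B {}C {}D {}E {}F e t + e0 t0 /=; rewrite ?expr1n ?expr0n.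
  case_zero A; case_zero D; case_zero E.
  by case: F => [|F] xp; [have := coefK xp (coef_BC B C) | rewrite /= addn1].
- by move=> A {}B {}C D E {}F /msupp_le[A2 F2 _] /=; rewrite oner_neq0; lia.
- by move=> A1 B1 C1 D1 E1 F1 A2 B2 C2 D2 E2 F2 _ _ /= *; split; split; lia.
Qed.

(** The conic a A^2 + D^2 + 2 B^2 = 0 with D = 1, B = e, A = t, after the line A = 0. *)
Lemma coef_ABD A B D : p@_(mon A B 0 D 0 0) = 0.
Proof.
case: A => [|A]; first exact: coef_BD.
apply: (@component_coef0 [:: 1; 0; a] [:: 2%:R] 1
  (fun A B C D E F => [&& C == 0, E == 0, F == 0 & 0 < A]%N)
  (fun A B C D E F => B) (fun A B C D E F => A.-1%N) (fun A B C D E F => 1) 0 1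
  (fun e t => [:: - e; 1]) (fun e t => [:: - t; 0; 1])
  (fun e t => [:: 0; 2%:R * t; 2%:R * e]) (fun e t => [:: 1; - (2%:R * e); a * t])
  (fun e t => [:: 0; 0; 1; 0; e; t]) 2) => //.
- by move=> x _; rewrite !horner_PolyE mul0r add0r ?oppr_eq0 ?oner_neq0.
- rewrite !horner_PolyE (_ : _ - _ = 2%:R * 2%:R * a); last by ring.
  by rewrite !mulf_neq0.
- move=> e t e0 t0 et; split; last by rewrite /= /of4 /= oner_neq0 ?orbT.
  have H : a * t ^+ 2 + 1 + 2%:R * e ^+ 2 = 0 by rewrite -[RHS]et !horner_PolyE; ring.
  by rewrite /relations /of4 /=; split; split; by_rel H.
- by_pluckers.
- by move=> e t e0 t0; exact: oner_neq0.
- move=> {}A {}B {}C {}D {}E {}F e t + e0 t0 /=; rewrite ?expr1n ?expr0n.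
  case_zero C; case_zero E; case_zero F.
  by case: A => [|A] xp; [have := coefK xp (coef_BD B D) | rewrite /= addn1; ring].
- by move=> {}A {}B C {}D E F /msupp_le[A2 F2 _] /=; rewrite oner_neq0; lia.
- by move=> A1 B1 C1 D1 E1 F1 A2 B2 C2 D2 E2 F2 _ _ /= *; split; split; lia.
Qed.

(** The plane cubic A (a A^2 - 2 A C + a C^2) = C E^2 with C = 1, A = t, E = e; the exponents 0, 1,
    2 of A stay below its degree in t. *)
Lemma coef_ACE A C E : p@_(mon A 0 C 0 E 0) = 0.
Proof.
apply: (@component_coef0 [:: 0; a; - 2%:R; a] [:: -1] 0
  (fun A B C D E F => [&& B == 0, D == 0 & F == 0]%N)
  (fun A B C D E F => E) (fun A B C D E F => A) (fun A B C D E F => 1) 0 0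
  (fun e t => [:: 1; - e]) (fun e t => [:: 0; t; 0; 1])
  (fun e t => [:: - t; 0; 0; - e]) (fun e t => [:: - e; a * t; 0; 2%:R * t - a * t ^+ 2])
  (fun e t => [:: 0; e; 0; 1; 0; t]) 3) => //.
- by move=> x _; rewrite !horner_PolyE mul0r add0r ?oppr_eq0 ?oner_neq0.
- rewrite !horner_PolyE (_ : _ - _ = - a); last by ring.
  by rewrite oppr_eq0.
- move=> e t e0 t0 et; split; last by rewrite /= /of4 /= oppr_eq0 t0 ?orbT.
  have H : a * t ^+ 3 - 2%:R * t ^+ 2 + a * t - e ^+ 2 = 0 by rewrite -[RHS]et !horner_PolyE; ring.
  by rewrite /relations /of4 /=; split; split; by_rel H.
- by_pluckers.
- by move=> e t e0 t0; exact: oner_neq0.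
- move=> {}A {}B {}C {}D {}E {}F e t + e0 t0 /=; rewrite ?expr1n ?expr0n.
  case_zero B; case_zero D; case_zero F.
  by rewrite addn0 mulrC.
- by move=> {}A B {}C D {}E F /msupp_le[A2 F2 _] /=; rewrite oner_neq0; lia.
- by move=> A1 B1 C1 D1 E1 F1 A2 B2 C2 D2 E2 F2 _ _ /= *; split; split; lia.
Qed.

(** The plane cubic F (D^2 + F^2) = D E^2 with D = 1, F = t, E = e. *)
Lemma coef_DEF D E F : p@_(mon 0 0 0 D E F) = 0.
Proof.
apply: (@component_coef0 [:: 0; 1; 0; 1] [:: -1] 0
  (fun A B C D E F => [&& A == 0, B == 0 & C == 0]%N)
  (fun A B C D E F => E) (fun A B C D E F => F) (fun A B C D E F => 1) 0 0
  (fun e t => [:: 0; 1; 0; - t]) (fun e t => [:: 0; 0; 1; - e])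
  (fun e t => [:: 0; t ^+ 2; e; t]) (fun e t => [:: 0; - e; - t; 0])
  (fun e t => [:: t; e; 1; 0; 0; 0]) 2) => //.
- exact: oner_neq0.
- by move=> x _; rewrite !horner_PolyE mul0r add0r ?oppr_eq0 ?oner_neq0.
- rewrite !horner_PolyE (_ : _ - _ = - 1); last by ring.
  by rewrite oppr_eq0 oner_neq0.
- move=> e t e0 t0 et; split; last by rewrite /= /of4 /= ?oppr_eq0 t0 ?orbT.
  have H : t ^+ 3 + t - e ^+ 2 = 0 by rewrite -[RHS]et !horner_PolyE; ring.
  by rewrite /relations /of4 /=; split; split; by_rel H.
- by_pluckers.
- by move=> e t e0 t0; exact: oner_neq0.
- move=> {}A {}B {}C {}D {}E {}F e t + e0 t0 /=; rewrite ?expr1n ?expr0n.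
  case_zero A; case_zero B; case_zero C.
  by rewrite addn0.
- by move=> A B C {}D {}E {}F /msupp_le[A2 F2 _] /=; rewrite oner_neq0; lia.
- by move=> A1 B1 C1 D1 E1 F1 A2 B2 C2 D2 E2 F2 _ _ /= *; split; split; lia.
Qed.

(** The curve A F = B E, a A^2 + F^2 + 2 B^2 = 0 with B = 1, F = t, E = e, A = e / t. As A F = 0 in
    the exponents and A <= 1, tau takes just the values 0 to 3, below the degree 4 of n. *)
Lemma coef_ABEF A B E F : p@_(mon A B 0 0 E F) = 0.
Proof.
have [lt1A | le_A1] := ltnP 1 A.
  have [//|] := eqVneq p@_(mon A B 0 0 E F) 0; rewrite -mcoeff_msupp => xp.
  have [std_x _] := msupp_standard xp; have [-> BE _] := standard_A2 std_x lt1A.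
  by case: BE => ->; [apply: coef_ACE | apply: coef_ABD].
apply: (@component_coef0 [:: 0; 0; 2%:R; 0; 1] [:: a] 1
  (fun A B C D E F => [&& C == 0, D == 0 & A <= 1]%N)
  (fun A B C D E F => (A + E)%N) (fun A B C D E F => (F + 1 - A)%N) (fun A B C D E F => 1) 1 0
  (fun e t => [:: 1; 0; 0; t]) (fun e t => [:: 0; e / t; -1; 0])
  (fun e t => [:: -1; 0; 0; - t]) (fun e t => [:: 0; - (a * (e / t)); - a; 0])
  (fun e t => [:: t; e; 0; 0; 1; e / t]) 4) => //.
- exact: oner_neq0.
- by move=> x _; rewrite !horner_PolyE mul0r add0r ?oppr_eq0 ?oner_neq0.
- rewrite !horner_PolyE (_ : _ - _ = 2%:R * 2%:R * 2%:R * a); last by ring.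
  by rewrite !mulf_neq0.
- move=> e t e0 t0 et; split; last by rewrite /= /of4 /= oppr_eq0 oner_neq0 ?orbT.
  have H : a * (e / t) ^+ 2 + t ^+ 2 + 2%:R = 0.
    apply: (mulIf (expf_neq0 2 t0)); rewrite mul0r -[RHS]et !horner_PolyE.
    by field.
  by rewrite /relations /of4 /=; split; split; by_rel H.
- by_pluckers.
- by move=> e t e0 t0; exact: oner_neq0.
- move=> {le_A1} {}A {}B {}C {}D {}E {}F e t + e0 t0 /=; rewrite ?expr1n ?expr0n.
  case_zero C; case_zero D => xp.
  case: A xp => [|[|A]] xp /=.
  - by rewrite add0n subn0 addn0 addn1 [in RHS]exprSr expr0 expr1 mul1r mulrA.
  - by rewrite addn0 addnK add1n [in RHS]exprS !expr1; field.
  - have [std_x _] := msupp_standard xp; have [F0 BE _] := standard_A2 std_x isT.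
    by have := coefK xp; rewrite F0; case: BE => ->; rewrite ?coef_ACE ?coef_ABD => /(_ erefl).
- by move=> {le_A1} {}A {}B C D {}E {}F /msupp_le[A2 F2 _] /=; rewrite oner_neq0; lia.
- by move=> A1 B1 C1 D1 E1 F1 A2 B2 C2 D2 E2 F2 /standard_le[_ p1 q1] /standard_le[_ p2 q2] /=;
  case: A1 A2 F1 F2 p1 q1 p2 q2 => [|A1] [|A2] [|F1] [|F2] //= *; split; split; lia.
Qed.

(** The curve A F = - C D, Q = 0 (with B = 0) for C = 1, A = t, D = e, F = - e / t. The factor t^2
    clears F^2, and tau again ranges over 0 to 3. *)
Lemma coef_ACDF A C D F : p@_(mon A 0 C D 0 F) = 0.
Proof.
have [lt1A | le_A1] := ltnP 1 A.
  have [//|] := eqVneq p@_(mon A 0 C D 0 F) 0; rewrite -mcoeff_msupp => xp.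
  have [std_x _] := msupp_standard xp; have [-> _ CD] := standard_A2 std_x lt1A.
  by case: CD => ->; [apply: coef_ABD | apply: coef_ACE].
apply: (@component_coef0 [:: 0; 0; a; - 2%:R; a] [:: 1; 0; 1] 1
  (fun A B C D E F => [&& B == 0, E == 0 & A <= 1]%N)
  (fun A B C D E F => (D + F)%N) (fun A B C D E F => (A + 2 - F)%N) (fun A B C D E F => (-1) ^+ F) 2 0
  (fun e t => [:: 1; 0; - (e / t); 0]) (fun e t => [:: 0; t; 0; 1])
  (fun e t => [:: - (t ^+ 2 + 1); 0; e / t * (t ^+ 2 + 1); 0]) (fun e t => [:: 0; 2%:R * t; 0; 2%:R])
  (fun e t => [:: - (e / t); 0; e; 1; 0; t]) 3) => //.
(* Division of n by m = x^2 + 1 leaves the remainder 2 x, so a common root would be 0, which is no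
   root of m. *)
- move=> x nx; apply/eqP => mx; have x0 : x = 0.
    have n0 : a * x ^+ 4 - 2%:R * x ^+ 3 + a * x ^+ 2 = 0.
      by rewrite -[RHS]nx !horner_PolyE; ring.
    have m0 : x ^+ 2 + 1 = 0 by rewrite -[RHS]mx !horner_PolyE; ring.
    apply: (mulfI two_neq0); rewrite mulr0.
    transitivity (a * x ^+ 4 - 2%:R * x ^+ 3 + a * x ^+ 2 -
      (a * x ^+ 2 - 2%:R * x) * (x ^+ 2 + 1)); first by ring.
    by rewrite n0 m0 mulr0 subrr.
  by move/eqP: mx; rewrite !horner_PolyE x0 !mulr0 add0r oner_eq0.
(* The Wronskian at 1 is 8 (a - 1), nonzero by [a_neq1]. *)
- rewrite !horner_PolyE (_ : _ - _ = 2%:R * 2%:R * 2%:R * (a - 1)); last by ring.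
  by rewrite !mulf_neq0 // subr_eq0.
- move=> e t e0 t0 et; split; last by rewrite /= /of4 /= (mulf_neq0 two_neq0 t0) !orbT ?orbT.
  have H : (e / t) ^+ 2 * (t ^+ 2 + 1) + a * t ^+ 2 - 2%:R * t + a = 0.
    apply: (mulIf (expf_neq0 2 t0)); rewrite mul0r -[RHS]et !horner_PolyE.
    by field.
  by rewrite /relations /of4 /=; split; split; by_rel H.
- by_pluckers.
- by move=> e t e0 t0; exact: oner_neq0.
- move=> {le_A1} {}A {}B {}C {}D {}E {}F e t + e0 t0 /=; rewrite ?expr1n ?expr0n.
  case_zero B; case_zero E => xp.
  have [std_x _] := msupp_standard xp; have [_ F2 AF] := standard_le std_x.
  case: A xp std_x AF => [|[|A]] xp std_x AF /=.
  - case: F F2 xp std_x AF => [|[|[|F]]] // _ _ _ _; rewrite ?addn0 ?addn1 ?addn2 ?exprS ?expr0; by field.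
  - have -> : F = 0%N by lia.
    by rewrite !addn0 subn0 ?exprS ?expr0; field.
  - have [F0 _ CD] := standard_A2 std_x isT.
    by have := coefK xp; rewrite F0; case: CD => ->; rewrite ?coef_ACE ?coef_ABD => /(_ erefl).
- by move=> {le_A1} {}A B {}C {}D E {}F /msupp_le[A2 F2 AF] /=; rewrite signr_eq0; lia.
- by move=> A1 B1 C1 D1 E1 F1 A2 B2 C2 D2 E2 F2 /standard_le[_ p1 q1] /standard_le[_ p2 q2] /=;
  case: A1 A2 F1 F2 p1 q1 p2 q2 => [|A1] [|A2] [|F1] [|F2] //= *; split; split; lia.
Qed.

(** Of the 64 possible supports, each standard one lies in the coordinate set of one of the six
    unions of curves treated above. *)
Lemma vanishing_standard_eq0 : p = 0.
Proof.
apply/mpolyP => x; rewrite mcoeff0.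
have [A [B [C [D [E [F ->]]]]]] := mon_surj x.
have [//|] := eqVneq p@_(mon A B C D E F) 0; rewrite -mcoeff_msupp => xp.
have [] := msupp_standard xp; rewrite standard_mon /standard_support => std_x _ {xp}.
case: A B C D E F std_x => [|A] [|B] [|C] [|D] [|E] [|F] //=; rewrite ?orbT //= => _;
  by rewrite ?(coef_BCF, coef_ABD, coef_ACE, coef_DEF, coef_ABEF, coef_ACDF).
Qed.

End Independence.

(** * Counting standard monomials *)

Section Counting.
Variable d : nat.
Hypothesis d_gt4 : (4 < d)%N.

(* [(A, F, x, y)] stands for the standard monomials with exponents [A] and [F]
   whose support among M24, M23, M14, M13 is the edge or vertex {x, y}. *)
Definition families : seq (nat * nat * nat * nat) :=
  [seq (0, 0, e.1, e.2) | e <- [:: (0, 0); (1, 1); (2, 2); (3, 3);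
     (0, 1); (0, 2); (0, 3); (1, 2); (1, 3); (2, 3)]] ++
  [seq (1, 0, e.1, e.2) | e <- [:: (0, 0); (1, 1); (2, 2); (3, 3);
     (0, 2); (0, 3); (1, 2); (1, 3)]] ++
  [seq (2, 0, e.1, e.2) | e <- [:: (0, 0); (1, 1); (2, 2); (3, 3); (0, 2); (1, 3)]] ++
  [seq (F, e.1, e.2) | F <- [:: (0, 1); (0, 2)], e <- [:: (0, 0); (1, 1); (2, 2); (3, 3);
     (0, 1); (0, 3); (1, 2); (2, 3)]]%N.

Definition family_size (e : nat * nat * nat * nat) :=
  let: (A, F, x, y) := e in if x == y then 1%N else (d - A - F).-1.

(** On an edge the exponents are j + 1 and d - A - F - j - 1, both positive; at a vertex x = y and j
    = 0, and the two summands add up to d - A - F. *)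
Definition family_exp (e : nat * nat * nat * nat) j z :=
  let: (A, F, x, y) := e in ((z == x) * j.+1 + (z == y) * (d - A - F - j.+1))%N.

Definition family_mon (e : nat * nat * nat * nat) j :=
  let: (A, F, x, y) := e in
  mon A (family_exp e j 0) (family_exp e j 1) (family_exp e j 2) (family_exp e j 3) F.

Definition standard_monomials : seq 'X_{1..6} :=
  [seq family_mon e j | e <- families, j <- iota 0 (family_size e)].

(** The 20 vertex families contribute 1 each and the 20 edge families d - A - F - 1 each. *)
Lemma size_standard_monomials : size standard_monomials = (20 * d - 20)%N.
Proof.
rewrite size_allpairs_dep -(eq_map (fun e => esym (size_iota 0 (family_size e)))) /=.
lia.
Qed.

Lemma families_bound e : e \in families ->
  let: (A, F, x, y) := e in [/\ A + F <= 2, x <= y & y <= 3]%N.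
Proof.
have /allP H : all (fun e : nat * nat * nat * nat =>
  let: (A, F, x, y) := e in [&& A + F <= 2, x <= y & y <= 3]%N) families by [].
by move/H; case: e => [[[A F] x] y] /and3P[].
Qed.

Lemma family_exp_gt0 e j z : e \in families -> (j < family_size e)%N ->
  let: (A, F, x, y) := e in (0 < family_exp e j z)%N = (z == x) || (z == y).
Proof.
move/families_bound; case: e => [[[A F] x] y] [AF xy y3] /=.
case: (x =P y) => x_y; case: (z =P x) => z_x; case: (z =P y) => z_y; rewrite ?mul0n ?mul1n /=; lia.
Qed.

(** A and F are read off the monomial, its support gives x <= y, and the exponent at x gives j. *)
Lemma family_mon_inj e j e' j' : e \in families -> e' \in families ->
  (j < family_size e)%N -> (j' < family_size e')%N ->
  family_mon e j = family_mon e' j' -> e = e' /\ j = j'.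
Proof.
move=> fe fe' lt_j lt_j'.
have := families_bound fe; have := families_bound fe'.
have := family_exp_gt0 _ fe lt_j; have := family_exp_gt0 _ fe' lt_j'.
case: e e' fe fe' lt_j lt_j' => [[[A F] x] y] [[[A' F'] x'] y'] _ _ lt_j lt_j' g0' g0.
move=> [AF' xy' y3'] [AF xy y3].
move=> /mon_inj[[eA e0 e1] [e2 e3 eF]].
have eq_exp z : (z <= 3)%N -> family_exp (A, F, x, y) j z = family_exp (A', F', x', y') j' z.
  by case: z => [|[|[|[|z]]]].
have eq_supp z : (z <= 3)%N -> ((z == x) || (z == y)) = ((z == x') || (z == y')).
  by move=> z3; rewrite -g0 -g0' eq_exp.
have ex : x = x' by have := eq_supp x; have := eq_supp x'; lia.
have ey : y = y' by have := eq_supp y; have := eq_supp y'; lia.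
subst x' y' A' F'; split=> //.
have := eq_exp x; move: lt_j lt_j'; rewrite /= eqxx; case: eqP => _; lia.
Qed.

Lemma uniq_standard_monomials : uniq standard_monomials.
Proof.
apply: allpairs_uniq_dep => [//|e _|]; first exact: iota_uniq.
move=> _ _ /allpairsPdep[e [j [fe + ->]]] /allpairsPdep[e' [j' [fe' + ->]]] /=.
rewrite !mem_iota !add0n => lt_j lt_j' /(family_mon_inj fe fe' lt_j lt_j')[-> ->] //.
Qed.

Lemma mem_standard_monomials m :
  (m \in standard_monomials) = standard m && (mdeg m == d).
Proof.
apply/allpairsPdep/andP => [[e [j [fe + ->]]]|[]].
  rewrite mem_iota add0n => /= lt_j; split.
    have /allP/(_ e fe) : all (fun e : nat * nat * nat * nat => let: (A, F, x, y) := e in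
        let g z := (z == x) || (z == y) in
        standard_support A F (g 0) (g 1) (g 2) (g 3))%N families by [].
    have := fun z => family_exp_gt0 z fe lt_j.
    by case: e {fe lt_j} => [[[A F] x] y] g0; rewrite standard_mon !g0.
  have := families_bound fe.
  move: lt_j; case: e {fe} => [[[A F] x] y]; rewrite mdeg_mon /= => lt_j [AF xy y3].
  move: lt_j; case: x y xy y3 => [|[|[|[|x]]]] [|[|[|[|y]]]] //= _ _; lia.
have [A [B [C [D [E [F ->]]]]]] := mon_surj m.
rewrite mdeg_mon => std_m /eqP dm; have [A2 F2 _] := standard_le std_m.
rewrite standard_mon in std_m.
have fin x y j : (A, F, x, y) \in families -> (j < family_size (A, F, x, y))%N ->
    mon A B C D E F = family_mon (A, F, x, y) j ->
    exists x y, [/\ x \in families, y \in iota 0 (family_size x) &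
                    mon A B C D E F = family_mon x y].
  by move=> ? ? ?; exists (A, F, x, y), j; rewrite mem_iota.
have famP x y : (let g z := (z == x) || (z == y) in
      standard_support A F (g 0) (g 1) (g 2) (g 3))%N ->
    (x <= y <= 3)%N -> (A, F, x, y) \in families.
  move: (A) (F) A2 F2 => [|[|[|A']]] [|[|[|F']]] //= _ _;
  by case: x y => [|[|[|[|x]]]] [|[|[|[|y]]]] //=; rewrite ?andbF.
have done_fin x y j : (x <= y <= 3)%N ->
    (let g z := ((z == x) || (z == y))%N in
     [/\ (0 < B) = g 0, (0 < C) = g 1, (0 < D) = g 2 & (0 < E) = g 3]%N) ->
    (j < family_size (A, F, x, y))%N ->
    mon A B C D E F = family_mon (A, F, x, y) j ->
    exists x y, [/\ x \in families, y \in iota 0 (family_size x) &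
                    mon A B C D E F = family_mon x y].
  move=> xy3 [gB gC gD gE] lt_j eq_m; apply: (fin x y j) => //.
  by apply: famP => //=; rewrite -gB -gC -gD -gE.
rewrite /standard_support in std_m.
(* Supports of three or four letters contain one of B C D, B C E, B D E, C D E; the empty one would
   give d = A + F <= 4. *)
case: B C D E std_m dm done_fin {fin famP} => [|B] [|C] [|D] [|E] /=;
  rewrite ?(andbF, andbT, orbT) //= => _ dm fin; first lia.
- by apply: (fin 3 3 0)%N => //; congr mon; lia.
- by apply: (fin 2 2 0)%N => //; congr mon; lia.
- by apply: (fin 2 3 D)%N => //; rewrite /=; [lia | congr mon; lia].
- by apply: (fin 1 1 0)%N => //; congr mon; lia.
- by apply: (fin 1 3 C)%N => //; rewrite /=; [lia | congr mon; lia].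
- by apply: (fin 1 2 C)%N => //; rewrite /=; [lia | congr mon; lia].
- by apply: (fin 0 0 0)%N => //; congr mon; lia.
- by apply: (fin 0 3 B)%N => //; rewrite /=; [lia | congr mon; lia].
- by apply: (fin 0 2 B)%N => //; rewrite /=; [lia | congr mon; lia].
- by apply: (fin 0 1 B)%N => //; rewrite /=; [lia | congr mon; lia].
Qed.

End Counting.

(** * Reducedness and degree *)

Section Assembly.
Variables (k : closedFieldType) (a : k).
Hypotheses (a_neq0 : a != 0) (a_neq1 : a != 1) (two_neq0 : 2%:R != 0 :> k).

Local Notation G := (line_gens a).

Lemma in_ideal_vanishing p : in_ideal G p -> vanishing a p.
Proof. by move=> Ip u v w w' ls _; apply: in_ideal_vanish ls Ip. Qed.

(** The reduced form of p also vanishes on the curves, hence is zero by independence. *)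
Lemma vanishing_homog_in_ideal d p : (4 < d)%N -> p \is d.-homog ->
  vanishing a p -> in_ideal G p.
Proof.
move=> d4 dp vp; have [r [dr std_r Ir]] := homog_reducible a_neq0 two_neq0 d4 dp.
suff r0 : r = 0 by rewrite -[p]subr0 -r0.
apply: (vanishing_standard_eq0 a_neq0 a_neq1 two_neq0 dr std_r) => u v w w' ls nz.
have := in_ideal_vanishing Ir ls nz; rewrite mevalB (vp _ _ _ _ ls nz) sub0r => /eqP.
by rewrite oppr_eq0 => /eqP.
Qed.

Lemma meval_homog_scale (R : comNzRingType) n d (p : {mpoly R[n]}) c (x : 'I_n -> R) :
  p \is d.-homog -> p.@[fun i => c * x i] = c ^+ d * p.@[x].
Proof.
move=> /dhomogP dp; rewrite !mevalE mulr_sumr; apply: eq_big_seq => m mp.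
under eq_bigr do rewrite exprMn.
by rewrite big_split prodrXr -mdegE (dp m mp) mulrCA.
Qed.

(* The line scheme is a cone: a polynomial vanishing on it vanishes on a punctured
   line through the origin, hence so do its homogeneous components. *)
Lemma vanishing_pihomog p d : vanishing a p -> vanishing a (pihomog mdeg d p).
Proof.
move=> vp u v w w' ls [i nz]; set x := pluckers u v in nz *.
pose q : {poly k} := \poly_(e < msize p) (pihomog mdeg e p).@[x].
(* The factor ['X] settles c = 0, where all scaled coordinates vanish and there is no point. *)
have q0 : 'X * q = 0.
  apply: poly_vanish => c; rewrite hornerM hornerX.
  have [->|c0] := eqVneq c 0; first by rewrite mul0r.
  have -> : q.[c] = p.@[fun i => c * x i].
    rewrite horner_poly [in RHS](pihomog_partitionE (leqnn (msize p))) raddf_sum /=.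
    by apply: eq_bigr => e _; rewrite (meval_homog_scale _ _ (pihomogP _ _ _)) mulrC.
  rewrite -(meval_eq p (pluckers_scale c u v)).
  rewrite (vp _ _ _ _ (on_line_scheme_scale c0 ls)) ?mulr0 //.
  by exists i; rewrite pluckers_scale mulf_neq0.
have := congr1 (fun q : {poly k} => q`_d.+1) q0; rewrite coefXM coef0 coef_poly /=.
case: ltnP => // le_pd _.
rewrite pihomogE big_seq_cond big1 ?meval0 // => m /andP[mp /eqP dm].
by have := msize_mdeg_lt mp; rewrite [mdeg m]dm ltnNge le_pd.
Qed.

(** At a point with i-th coordinate nonzero, the vanishing of ['X_i ^+ N * p ^+ m] forces that of
    p. *)
Lemma saturation_vanishing p m : in_saturation G (p ^+ m) -> vanishing a p.
Proof.
move=> [N Isat] u v w w' ls [i nz].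
have := in_ideal_vanish ls (Isat i); rewrite mevalM !rmorphXn /= mevalXU => /eqP.
rewrite mulf_eq0 expf_eq0 (negPf nz) andbF /= expf_eq0 => /andP[_].
by move/eqP.
Qed.

Lemma vanishing_saturation p : vanishing a p -> in_saturation G p.
Proof.
(* The exponent 5 lifts every homogeneous component of p to a degree above 4. *)
move=> vp; exists 5 => i; rewrite [p](pihomog_partitionE (leqnn (msize p))) mulr_sumr.
apply: in_ideal_sum => e _; apply: (@vanishing_homog_in_ideal (5 + e)) => //.
  apply: dhomogM; last exact: pihomogP.
  by rewrite mpolyXn dhomogX /= mdegMn mdeg1 mul1n.
by move=> u v w w' ls nz; rewrite mevalM (vanishing_pihomog _ vp ls nz) mulr0.
Qed.

Lemma hilb_fun_line_gens d : (4 < d)%N -> hilb_fun G d (20 * d - 20).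
Proof.
move=> d4; set L := standard_monomials d.
have szL : size L = (20 * d - 20)%N := size_standard_monomials d4.
have lt_iL (i : 'I_(20 * d - 20)) : (i < size L)%N by rewrite szL.
have memL i : (i < size L)%N -> standard (nth 0%MM L i) && (mdeg (nth 0%MM L i) == d).
  by move=> lt_i; rewrite -mem_standard_monomials // mem_nth.
exists (fun i => 'X_[nth 0%MM L i]); split; last split.
- by move=> i; rewrite dhomogX /=; have /andP[] := memL i (lt_iL i).
- move=> c; set p := \sum_(i < _) _ => Ip.
  have supp_p m : m \in msupp p -> m \in L.
    move/msupp_sum_le => /flatten_mapP[i _] /msuppZ_le; rewrite msuppX inE => /eqP->.
    by rewrite mem_nth ?szL.
  have p0 : p = 0.
    apply: (@vanishing_standard_eq0 k a a_neq0 a_neq1 two_neq0 d); last exact: in_ideal_vanishing.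
      by apply/dhomogP => m /supp_p; rewrite mem_standard_monomials // => /andP[_ /eqP].
    by apply/allP => m /supp_p; rewrite mem_standard_monomials // => /andP[].
  move=> i; have := congr1 (mcoeff (nth 0%MM L i)) p0.
  rewrite mcoeff0 raddf_sum (bigD1 i) //= mcoeffZ mcoeffX eqxx mulr1 big1 ?addr0 // => j neq_ji.
  rewrite mcoeffZ mcoeffX nth_uniq ?szL ?uniq_standard_monomials //.
  by rewrite val_eqE (negPf neq_ji) mulr0.
move=> p dp; have [r [dr std_r Ir]] := homog_reducible a_neq0 two_neq0 d4 dp.
exists (fun i => r@_(nth 0%MM L i)).
suff <- : r = \sum_(i < 20 * d - 20) r@_(nth 0%MM L i) *: 'X_[nth 0%MM L i] by [].
rewrite -szL -(big_mkord xpredT (fun i => r@_(nth 0%MM L i) *: 'X_[nth 0%MM L i])).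
rewrite -(big_nth 0%MM xpredT (fun m => r@_m *: 'X_[m])).
apply/mpolyP => m; rewrite raddf_sum /=.
under eq_bigr do rewrite mcoeffZ mcoeffX.
have [mL|mL] := boolP (m \in L).
  rewrite (bigD1_seq m) ?uniq_standard_monomials //= eqxx mulr1 big1 ?addr0 // => j.
  by move=> /negPf->; rewrite mulr0.
rewrite big_seq big1 => [|j jL]; last by case: eqP mL => [<-|]; rewrite ?jL ?mulr0.
apply/memN_msupp_eq0/negP => mr; case/negP: mL.
rewrite mem_standard_monomials // (allP std_r) //=; apply/eqP.
by have /dhomogP/(_ _ mr) := dr.
Qed.

End Assembly.

Theorem theorem3p2 (k : closedFieldType) (hchar : [pchar k] =i pred0)
  (a : k) (ha : a * (1 - a ^+ 2) != 0) :
  proj_reduced (line_gens a) /\ proj_degree (line_gens a) 20.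
Proof.
have two_neq0 : 2%:R != 0 :> k.
  by apply/negP => two0; have := hchar 2; rewrite !inE two0.
have a_neq0 : a != 0 by apply: contraNneq ha => ->; rewrite mul0r.
have a_neq1 : a != 1 by apply: contraNneq ha => ->; rewrite expr1n subrr mulr0.
split.
  move=> p m /(saturation_vanishing (a := a)); exact: vanishing_saturation.
(* The Hilbert polynomial is 20 d - 20, attained from degree 5 on; it has degree 1, so the degree of
   the scheme is 1! times 20. *)
exists (20%:R *: ('X - 1)), 5; split.
  move=> d d5; exists (20 * d - 20)%N; split; first exact: hilb_fun_line_gens.
  rewrite !hornerE natrB ?natrM; last by lia.
  by ring.
rewrite lead_coefZ size_scale // -['X - 1]/('X - 1%:P) size_XsubC lead_coefXsubC /=.
by [].
Qed.
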